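(* Let $U$ be a star-shaped open region of an $n$-dimensional Riemannian manifold. For every $0\le k\le n$ there is a direct sum decomposition (of real vector spaces) $$\Lambda^k(U)=\mathcal{C}^k(U)\oplus\mathcal{Y}^k(U).$$
   Context: A star-shaped open region $U$ of a smooth manifold $M$ with $\dim M=n\ge 1$ is an open subset diffeomorphic to an open ball in $\mathbb{R}^n$; fix such a diffeomorphism, use the resulting coordinates $x=(x^1,\dots,x^n)$ on $U$, and fix $x_0\in U$. $\Lambda^k(U)$ denotes smooth $k$-forms on $U$ and $\Lambda(U)=\bigoplus_k\Lambda^k(U)$. $U$ is oriented and carries a Riemannian metric $g$ (arbitrary, not necessarily flat), with standard Hodge star $\star$. $\eta\omega=(-1)^p\omega$ for $\omega\in\Lambda^p(U)$. Codifferential: $\delta=\star^{-1}d\star\eta$ (zero on $0$-forms). Homotopy operator: with $\mathcal{K}=(x-x_0)^i\partial_i$ and $F(t,x)=x_0+t(x-x_0)$, for $\omega\in\Lambda^k(U)$, $k\ge1$, $$H\omega=\int_0^1 i_{\mathcal{K}}\,\omega|_{F(t,x)}\,t^{k-1}\,dt\in\Lambda^{k-1}(U),$$ where $\omega|_{F(t,x)}$ means that the coefficients of $\omega$ in the basis $dx^I$ are evaluated at $F(t,x)$ (the $dx^I$ unchanged) and $\mathcal{K}$ is taken at $x$; $H=0$ on $0$-forms. Cohomotopy operator: $h=\eta\star^{-1}H\star$, mapping $\Lambda^r(U)$ to $\Lambda^{r+1}(U)$ (zero on $n$-forms). $\mathcal{C}^k(U)=\{\omega\in\Lambda^k(U):\delta\omega=0\}$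 (coexact forms) and $\mathcal{Y}^k(U)=\{\omega\in\Lambda^k(U):\omega=h\delta\omega\}$ (anticoexact forms). *)

(* Defs.v *)
From HB Require Import structures.
From mathcomp Require Import all_boot all_order all_algebra.
From mathcomp Require Import all_classical all_reals all_analysis.

Set Implicit Arguments.
Unset Strict Implicit.
Unset Printing Implicit Defensive.

Import Order.TTheory GRing.Theory Num.Theory numFieldNormedType.Exports.

Local Open Scope classical_set_scope.
Local Open Scope ring_scope.

(** * Exterior algebra of the dual of R^n *)

(* [a I] is the coefficient in [a : ext R n] of
   dx^I := dx^{i_1} /\ ... /\ dx^{i_k}, where i_1 < ... < i_k are the elements
   of I. *)
Notation ext R n := {ffun {set 'I_n} -> R^o}.

Section exterior_algebra.
Context {R : realType} {n : nat}.
Local Notation ext := (ext R n).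

Implicit Types (a b : ext) (I J K : {set 'I_n}) (v : 'rV[R]_n) (G : 'M[R]_n).

Definition homogeneous (k : nat) a := forall I, #|I| != k -> a I = 0.

Definition dx I : ext := [ffun J : {set 'I_n} => (J == I)%:R].

(* dx^I /\ dx^J = shuffle_sign I J * dx^(I :|: J) for disjoint I and J: one
   transposition for each inversion of the concatenated multi-index. *)
Definition shuffle_sign I J : R :=
  (-1) ^+ #|[pred p in finset.setX I J | (p.2 < p.1)%N]|.

Definition wedge a b : ext :=
  [ffun K : {set 'I_n} =>
     \sum_(I : {set 'I_n} | I \subset K)
        shuffle_sign I (K :\: I) * a I * b (K :\: I)].

(* i_v a, with the convention (i_v a)(v_2, ..., v_k) = a(v, v_2, ..., v_k). *)
Definition interior_product v a : ext :=
  [ffun J : {set 'I_n} =>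
     \sum_(i < n | i \notin J)
        shuffle_sign [set i]%SET J * v ord0 i * a (i |: J)].

Definition grade_involution a : ext :=
  [ffun I : {set 'I_n} => (-1) ^+ #|I| * a I].

(* The scalar product of dx^I and dx^J for the metric with matrix G: the Gram
   determinant of the g(dx^i, dx^j) = (G^-1)_ij, for i in I and j in J taken in
   increasing order ([enum_val p] is only a default value for [nth]). *)
Definition gram G I J : R :=
  if #|I| == #|J| then
    \det (\matrix_(p < #|I|, q < #|I|)
            invmx G (enum_val p) (nth (enum_val p) (enum J) q))
  else 0.

Definition ext_dot G a b : R := \sum_I \sum_J gram G I J * a I * b J.

(* The orientation is given by its sign with respect to dx^1 /\ ... /\ dx^n:
   positive for o = false, negative for o = true. *)
Definition volume G (o : bool) : ext :=
  ((-1) ^+ o * Num.sqrt (\det G)) *: dx [set: 'I_n]%SET.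

(* The coefficients forced by a /\ *b = <a, b> vol; see [wedge_hodge]. *)
Definition hodge G (o : bool) b : ext :=
  [ffun J : {set 'I_n} =>
     shuffle_sign (~: J) J * ((-1) ^+ o * Num.sqrt (\det G)) *
     \sum_K gram G (~: J) K * b K].

(* For G positive definite [hodge G o] is a bijection, and this is its inverse. *)
Definition hodge_inv G (o : bool) : ext -> ext :=
  'pinv_(fun=> 0) setT (hodge G o).

Lemma wedge_hodge G o (k : nat) a b : homogeneous k a -> homogeneous k b ->
  wedge a (hodge G o b) = ext_dot G a b *: volume G o.
Proof.
move=> ha hb; apply/ffunP => K; rewrite !ffunE.
have [->|KT] := eqVneq K [set: 'I_n]%SET.
  rewrite /ext_dot; set s := _ * Num.sqrt _.
  rewrite (eq_bigl xpredT); last by move=> I; rewrite finset.subsetT.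
  rewrite scaler1 /GRing.scale/= mulr_suml; apply: eq_bigr => I _.
  rewrite !ffunE finset.setTD finset.setCK.
  have ss : shuffle_sign I (~: I) * shuffle_sign I (~: I) = 1.
    by rewrite /shuffle_sign -signr_odd -signr_addb addbb.
  transitivity ((shuffle_sign I (~: I) * shuffle_sign I (~: I)) *
    (a I * ((\sum_J gram G I J * b J) * s))).
    by rewrite -/s -[_ * s * _]mulrA mulrACA [s * _]mulrC.
  rewrite ss mul1r mulrA; congr (_ * _).
  rewrite mulr_sumr; apply: eq_bigr => J _.
  by rewrite mulrA [a I * _]mulrC.
rewrite scaler0 scaler0 big1// => I IK.
have [Ik|/ha ->] := eqVneq #|I| k; last by rewrite mulr0 mul0r.
rewrite !ffunE [X in _ * (_ * X)]big1 ?mulr0// => J _.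
have [Jk|/hb ->] := eqVneq #|J| k; last by rewrite mulr0.
rewrite /gram ifN ?mul0r// Jk -Ik finset.setCD finset.setUC.
rewrite neq_ltn; apply/orP; right; apply: proper_card.
rewrite properE finset.subsetUl/=; apply: contra KT => H.
rewrite -finset.subTset; apply/fintype.subsetP => x _.
apply/negPn/negP => xK; have := fintype.subsetP H x.
rewrite !inE xK orbT => /(_ isT) xI.
by move/fintype.subsetP : IK => /(_ x xI); exact/negP.
Qed.

End exterior_algebra.

(** * Differential forms in a coordinate domain U of R^n *)

Notation form R n := ('rV[R]_n -> ext R n).

Section differential_forms.
Context {R : realType} {n : nat}.
Local Notation form := (form R n).

Definition euclidean_ball (c : 'rV[R]_n) (r : R) : set 'rV[R]_n :=
  [set x | \sum_i (x ord0 i - c ord0 i) ^+ 2 < r ^+ 2].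

Definition partial (i : 'I_n) (f : 'rV[R]_n -> R) (x : 'rV[R]_n) : R :=
  'D_(delta_mx ord0 i) f x.

Fixpoint Ck (m : nat) (U : set 'rV[R]_n) (f : 'rV[R]_n -> R) : Prop :=
  (forall x, U x -> {for x, continuous f}) /\
  if m is m'.+1 then
    forall i : 'I_n, (forall x, U x -> derivable f x (delta_mx ord0 i)) /\
                     Ck m' U (partial i f)
  else True.

Definition smooth (U : set 'rV[R]_n) (f : 'rV[R]_n -> R) : Prop :=
  forall m, Ck m U f.

Definition riemannian_metric (U : set 'rV[R]_n) (g : 'rV[R]_n -> 'M[R]_n) :=
  [/\ forall i j, smooth U (fun x => g x i j),
      forall x, U x -> (g x)^T = g x &
      forall x, U x -> forall v : 'rV[R]_n, v != 0 ->
        0 < (v *m g x *m v^T) ord0 ord0].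

Implicit Types (U : set 'rV[R]_n) (w : form) (g : 'rV[R]_n -> 'M[R]_n).

(* A form on U is represented by its extension by 0 outside U, so that two
   forms on U are the same if and only if their representatives are equal. *)
Definition Lambda (k : nat) U : set form :=
  [set w | [/\ forall x, ~ U x -> w x = 0,
               forall x, homogeneous k (w x) &
               forall I, smooth U (fun x => w x I)]].

(* The operators below act on all functions of type [form].  When U is open and
   star-shaped with respect to x0, their values on U only depend on the values
   of the argument on U; their values outside U are irrelevant. *)

Definition eta w : form := fun x => grade_involution (w x).

Definition star g (o : bool) w : form := fun x => hodge (g x) o (w x).

Definition star_inv g (o : bool) w : form := fun x => hodge_inv (g x) o (w x).

Definition ext_d w : form := fun x =>
  \sum_(i < n) wedge (dx [set i]%SET)
                     [ffun I : {set 'I_n} => partial i (fun y => w y I) x].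

Definition codiff g (o : bool) w : form :=
  star_inv g o (ext_d (star g o (eta w))).

(* On k-forms only the coefficients with #|J| = k - 1 can be nonzero, whence the
   factor t ^ (k - 1); on 0-forms the interior product vanishes. *)
Definition homotopy (x0 : 'rV[R]_n) w : form := fun x =>
  [ffun J : {set 'I_n} =>
     \int[lebesgue_measure]_(t in `[0, 1])
        (interior_product (x - x0) (w (x0 + t *: (x - x0))) J * t ^+ #|J|)]%R.

Definition cohomotopy g (o : bool) (x0 : 'rV[R]_n) w : form :=
  eta (star_inv g o (homotopy x0 (star g o w))).

Definition coexact (k : nat) U g (o : bool) : set form :=
  [set w | Lambda k U w /\ forall x, U x -> codiff g o w x = 0].

Definition anticoexact (k : nat) U g (o : bool) (x0 : 'rV[R]_n) : set form :=
  [set w | Lambda k U w /\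
           forall x, U x -> w x = cohomotopy g o x0 (codiff g o w) x].

End differential_forms.

(* W is the internal direct sum of its linear subspaces A and B. *)
Definition direct_sum (R : realType) (V : lmodType R) (W A B : set V) : Prop :=
  [/\ submod_closed (mem A), submod_closed (mem B), A `&` B = [set 0] &
      W = [set a + b | a in A & b in B]].

(* Main.v *)
Require Import Defs.
From mathcomp Require Import all_boot all_order all_algebra.
From mathcomp Require Import all_classical all_reals all_analysis.
From mathcomp Require Import perm ring lra.

Set Implicit Arguments.
Unset Strict Implicit.
Unset Printing Implicit Defensive.

Import Order.TTheory GRing.Theory Num.Theory numFieldNormedType.Exports.

Local Open Scope classical_set_scope.
Local Open Scope ring_scope.

(* The operator h delta is a projection of Lambda^k(U) with kernel C^k(U) and
   fixed space Y^k(U), because delta h delta = delta.  Cancelling the Hodge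
   stars and the signs eta, this says that d H d = d, i.e. that d H b = b for
   b = d w.  Such a b is closed (d d = 0, by the symmetry of second
   derivatives), and for a closed b the I-th coefficient of d H b at x is
   int_0^1 d/dt (t^k b_I(x0 + t (x - x0))) dt = b_I(x), with k = #|I| > 0.
   That h delta preserves smoothness requires differentiating H w under the
   integral sign, and an explicit inverse of the Hodge star: its coefficients
   are minors of g^-1, so by Cauchy-Binet those of its inverse are minors of
   g. *)

(** * Minors and the inverse of the Hodge star *)

(** Two features of the definitions shape the proof. A function in [Ck] is only known to have
    iterated partial derivatives that are continuous on the open set [U]; nothing is said about
    total differentiability. The symmetry of second derivatives and the formula for the derivative
    in an arbitrary direction are therefore drawn from the mean value theorem along lines. Secondly,
    [hodge_inv] is a pseudo-inverse obtained by choice, from which no regularity can be read; hence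
    the detour through minors. It also needs [\det (g x)] to be positive on [U], so that its square
    root is smooth and invertible. Star-shapedness enters as [Ustar]: every point of [U] has a
    compact neighbourhood in [U] that is itself star-shaped about [x0]. Compactness bounds
    continuous functions uniformly along the segments from [x0] to all nearby points, which provides
    a constant dominating function for differentiation under the integral sign. The identities
    between the operators are used on [U] only, where [g] is a metric, whereas forms vanish outside
    [U]: the projection has to be cut off there. *)

Section cauchy_binet.
Context {R : comNzRingType} {n : nat} (i0 : 'I_n).
Implicit Types (I J K : {set 'I_n}) (A B : 'M[R]_n).

Local Notation elt I p := (nth i0 (enum (mem I)) p).

Lemma elt_inj k I : #|I| = k -> injective (fun p : 'I_k => elt I p).
Proof.
move=> Ik p q /eqP; rewrite nth_uniq ?enum_uniq -?cardE ?Ik//.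
by move/eqP/val_inj.
Qed.

Lemma elt_in k I (p : 'I_k) : #|I| = k -> elt I p \in I.
Proof. by move=> Ik; rewrite -mem_enum mem_nth// -cardE Ik. Qed.

(** Multilinearity in the rows: each row of [A *m B] is a combination of rows of [B], and [f]
    records which row is picked for each [p]. *)
Lemma det_mulmx_ffun k (A : 'M[R]_(k, n)) (B : 'M[R]_(n, k)) :
  \det (A *m B) = \sum_(f : {ffun 'I_k -> 'I_n})
     (\prod_p A p (f p)) * \det (rowsub f B).
Proof.
rewrite /determinant; under eq_bigr => s _.
  under eq_bigr => p _ do rewrite mxE.
  rewrite bigA_distr_bigA/= mulr_sumr.
  over.
rewrite exchange_big/=; apply: eq_bigr => f _.
rewrite mulr_sumr; apply: eq_bigr => s _.
rewrite big_split/= mulrCA; congr (_ * (_ * _)).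
by apply: eq_bigr => p _; rewrite mxE.
Qed.

(** In the expansion over maps [f], a non-injective [f] repeats a row of [B] and contributes 0. The
    injective ones are grouped by their image [K]; within a group they differ by permutations, whose
    signs rebuild the determinant of the columns of [A]. *)
Lemma cauchy_binet k (A : 'M[R]_(k, n)) (B : 'M[R]_(n, k)) :
  \det (A *m B) = \sum_(K : {set 'I_n} | #|K| == k)
     \det (colsub (fun p : 'I_k => elt K p) A) *
     \det (rowsub (fun p : 'I_k => elt K p) B).
Proof.
rewrite det_mulmx_ffun (bigID (fun f : {ffun 'I_k -> 'I_n} => injectiveb f))/=.
rewrite [X in _ + X]big1 ?addr0; last first.
  move=> f /injectivePn[p [q pq fpq]].
  rewrite [\det _](@determinant_alternate _ _ _ p q) ?mulr0//.
  by move=> r; rewrite !mxE fpq.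
rewrite (partition_big (fun f : {ffun 'I_k -> 'I_n} => f @: [set: 'I_k]%SET)
   (fun K => #|K| == k))/=; last first.
  by move=> f /injectiveP f_inj; rewrite card_imset// cardsT card_ord.
apply: eq_bigr => K /eqP Kk.
(* [h] and [h'] match permutations with the injective maps of image [K]; the default [1%g] is never
   reached on such maps. *)
pose h (s : 'S_k) : {ffun 'I_k -> 'I_n} := [ffun p => elt K (s p)].
pose h' (f : {ffun 'I_k -> 'I_n}) : 'S_k :=
  odflt 1%g [pick s : 'S_k | h s == f].
rewrite (reindex_onto h h'); last first.
  move=> f /andP[/injectiveP f_inj /eqP fK].
  rewrite /h'; case: pickP => [s /eqP//|/= nos].
  have fin p : f p \in enum K by rewrite mem_enum -fK imset_f.
  have ltk p : (index (f p) (enum K) < k)%N.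
    by have := fin p; rewrite -index_mem -cardE Kk.
  have s_inj : injective (fun p => Ordinal (ltk p)).
    move=> p q [] pq; apply: f_inj.
    by rewrite -(nth_index i0 (fin p)) pq nth_index.
  have /eqP := nos (perm s_inj); case.
  apply/ffunP => p; rewrite !ffunE permE/= nth_index//; exact: fin.
rewrite [X in X * _]/determinant mulr_suml.
have h'h s : h' (h s) = s.
  rewrite /h'; case: pickP => [t /eqP hts/=|/(_ s)]; last by rewrite eqxx.
  apply/permP => p; have /ffunP/(_ p) := hts; rewrite !ffunE.
  exact: elt_inj.
apply: eq_big => [s|s _].
  rewrite h'h eqxx andbT; apply/andP; split.
    apply/injectiveP => p q; rewrite !ffunE => /(elt_inj Kk).
    exact: perm_inj.
  rewrite eqEcard; apply/andP; split.
    apply/fintype.subsetP => x /imsetP[p _ ->]; rewrite ffunE; exact: elt_in.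
  rewrite card_imset ?cardsT ?card_ord ?Kk// => p q.
  by rewrite !ffunE => /(elt_inj Kk)/perm_inj.
have -> : rowsub (h s) B = row_perm s (rowsub (fun p : 'I_k => elt K p) B).
  by apply/matrixP => p q; rewrite !mxE ffunE.
rewrite row_permE det_mulmx det_perm mulrA [_ * (-1) ^+ _]mulrC.
congr (_ * _ * _); apply: eq_bigr => p _; by rewrite mxE ffunE.
Qed.

End cauchy_binet.

Section minors.
Context {R : comNzRingType} {n : nat}.
Implicit Types (I J K : {set 'I_n}) (A B : 'M[R]_n).

(** The body is that of [gram] with [A] in place of [invmx G], so that [gram G] and
    [minor (invmx G)] are convertible. *)
Definition minor A I J : R :=
  if #|I| == #|J| then
    \det (\matrix_(p < #|I|, q < #|I|)
            A (enum_val p) (nth (enum_val p) (enum J) q))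
  else 0.

(** In [minor] the size of the matrix depends on [I] and the default of [nth] on the row; a common
    size [k] and default [i0] make the matrices of different index sets comparable. *)
Lemma minorE i0 k A I J : #|I| = k -> #|J| = k -> minor A I J =
  \det (\matrix_(p < k, q < k) A (nth i0 (enum I) p) (nth i0 (enum J) q)).
Proof.
move=> <- Jk; rewrite /minor Jk eqxx.
congr (\det _); apply/matrixP => p q; rewrite !mxE.
congr (A _ _); last by apply: set_nth_default; rewrite -cardE Jk ltn_ord.
by rewrite /enum_val; apply: set_nth_default; rewrite -cardE ltn_ord.
Qed.

Lemma minor_eq0 A I J : #|I| != #|J| -> minor A I J = 0.
Proof. by rewrite /minor => /negPf ->. Qed.

Hypothesis n_gt0 : (0 < n)%N.

(** The minors of a given size form the compound matrix, which is the matrix of an exterior power;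
    Cauchy-Binet is its multiplicativity. *)
Lemma minor_mulmx A B I J :
  \sum_K minor A I K * minor B K J = minor (A *m B) I J.
Proof.
have [IJ|IJ] := eqVneq #|I| #|J|; last first.
  rewrite minor_eq0// big1// => K _.
  have [IK|IK] := eqVneq #|I| #|K|; last by rewrite minor_eq0// mul0r.
  by rewrite [X in _ * X]minor_eq0 ?mulr0// -IK.
pose i0 := Ordinal n_gt0.
rewrite (minorE i0 _ (erefl #|I|) (esym IJ)) (bigID (fun K => #|K| == #|I|))/=.
rewrite [X in _ + X]big1 ?addr0; last first.
  by move=> K KI; rewrite minor_eq0 ?mul0r// eq_sym.
pose A' := \matrix_(p < #|I|, x < n) A (nth i0 (enum I) p) x.
pose B' := \matrix_(x < n, q < #|I|) B x (nth i0 (enum J) q).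
transitivity (\det (A' *m B')); last first.
  congr (\det _); apply/matrixP => p q; rewrite !mxE.
  by apply: eq_bigr => x _; rewrite !mxE.
rewrite (cauchy_binet i0); apply: eq_bigr => K /eqP KI.
rewrite (minorE i0 _ (erefl #|I|) KI) (minorE i0 _ KI (esym IJ)).
by congr (_ * _); congr (\det _); apply/matrixP => p q; rewrite !mxE.
Qed.

Lemma minor1 I J : minor 1%:M I J = (I == J)%:R.
Proof.
have [IJ|IJ] := eqVneq #|I| #|J|; last first.
  by rewrite minor_eq0//; move: IJ; have [->|//] := eqVneq I J; rewrite eqxx.
pose i0 := Ordinal n_gt0.
rewrite (minorE i0 _ (erefl #|I|) (esym IJ)).
have [<-|nIJ] := eqVneq I J.
  rewrite (_ : \matrix_(p, q) _ = 1%:M) ?det1//.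
  apply/matrixP => p q; rewrite !mxE nth_uniq ?enum_uniq -?cardE//.
(* An element of [I] outside [J] indexes a row of zeros. *)
have /fintype.subsetPn[x xI xJ] : ~~ (I \subset J).
  by apply: contraNN nIJ => sIJ; rewrite eqEcard sIJ IJ leqnn.
have xltI : (index x (enum I) < #|I|)%N by rewrite cardE index_mem mem_enum.
rewrite (expand_det_row _ (Ordinal xltI)) big1// => q _.
rewrite !mxE/= nth_index ?mem_enum//.
case: eqVneq => [E|]; last by rewrite mul0r.
by move: xJ; rewrite [in X in X -> _]E -mem_enum mem_nth// -cardE -IJ.
Qed.

End minors.

(** * Determinants of positive definite matrices *)

Section positive_definite.
Context {R : rcfType}.

Lemma posdef_det_neq0 n (G : 'M[R]_n) :
  (forall v : 'rV[R]_n, v != 0 -> 0 < (v *m G *m v^T) ord0 ord0) ->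
  \det G != 0.
Proof.
move=> Gpos; apply/negP => /det0P[v v0 vG].
by have := Gpos v v0; rewrite vG mul0mx mxE ltxx.
Qed.

Lemma dotmx_gt0 n (v : 'rV[R]_n) : v != 0 -> 0 < (v *m v^T) ord0 ord0.
Proof.
move=> v0; rewrite mxE lt_neqAle; apply/andP; split; last first.
  by apply: sumr_ge0 => i _; rewrite !mxE -expr2 sqr_ge0.
apply: contra v0; rewrite eq_sym psumr_eq0; last first.
  by move=> i _; rewrite !mxE -expr2 sqr_ge0.
move/allP => H; apply/eqP/rowP => i; rewrite mxE.
have := H i (mem_index_enum i); rewrite /= !mxE -expr2 sqrf_eq0 => /eqP.
by rewrite (ord1 ord0).
Qed.

(* The determinant cannot change sign along the segment from the identity to G. *)
Lemma posdef_det_gt0 n (G : 'M[R]_n) :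
  (forall v : 'rV[R]_n, v != 0 -> 0 < (v *m G *m v^T) ord0 ord0) ->
  0 < \det G.
Proof.
move=> Gpos; rewrite ltNge; apply/negP => G0.
(* With polynomial entries, the determinant along the segment is a polynomial, and [poly_ivt] finds
   its zero. *)
pose M : 'M[{poly R}]_n := map_mx polyC 1%:M + 'X *: map_mx polyC (G - 1%:M).
have Mt t : (\det M).[t] = \det (1%:M + t *: (G - 1%:M)).
  rewrite -/(horner_eval t (\det M)) -det_map_mx; congr (\det _).
  apply/matrixP => i j; rewrite !mxE.
  by rewrite -[LHS]/(horner _ t) !hornerE.
have [||t t01 /rootP] := @poly_ivt _ (- \det M) 0 1; first exact: ler01.
  rewrite !hornerN !Mt scale0r addr0 det1 scale1r addrC subrK.
  by rewrite oppr_le0 ler01 oppr_ge0.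
rewrite hornerN Mt => /eqP; rewrite oppr_eq0; apply/negP.
apply: posdef_det_neq0 => v v0.
move: t01 => /andP[t0 t1].
rewrite mulmxDr mulmxDl mulmx1 -scalemxAr -scalemxAl mulmxBr mulmx1 mulmxBl.
have := Gpos v v0; have := dotmx_gt0 v0; rewrite !mxE => p1 p2.
move: p1 p2; move: (\sum_j _) (\sum_j _) => a b a0 b0.
by have [ab|ab] := lerP a b; nra.
Qed.

End positive_definite.

(** * An explicit inverse of the Hodge star *)

Section hodge_inverse.
Context {R : realType} {n : nat}.
Hypothesis n_gt0 : (0 < n)%N.
Implicit Types (I J K : {set 'I_n}) (G : 'M[R]_n) (a b : ext R n).

Lemma gram_minor G I J : gram G I J = minor (invmx G) I J.
Proof. by []. Qed.

Lemma shuffle_sign_sqr I J : shuffle_sign I J * shuffle_sign I J = 1 :> R.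
Proof. by rewrite /shuffle_sign -signr_odd -signr_addb addbb. Qed.

(** Undoes the factors of [hodge] in reverse order: the complement with its sign, whose square is 1,
    the volume factor, and the compound matrix of [invmx G], inverted by that of [G]. *)
Definition hodge_inverse G (o : bool) a : ext R n :=
  [ffun K : {set 'I_n} => \sum_I minor G K I *
     (shuffle_sign I (~: I) * ((-1) ^+ o * Num.sqrt (\det G))^-1 * a (~: I))].

Section fixed_metric.
Variables (G : 'M[R]_n) (o : bool).
Hypothesis G_gt0 : 0 < \det G.

Let s := (-1) ^+ o * Num.sqrt (\det G).

Let s_neq0 : s != 0.
Proof. by rewrite /s mulf_neq0 ?signr_eq0// sqrtr_eq0 -ltNge. Qed.

Let G_unit : G \in unitmx.
Proof. by rewrite unitmxE unitfE gt_eqF. Qed.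

Lemma hodgeK : cancel (hodge G o) (hodge_inverse G o).
Proof.
move=> b; apply/ffunP => K; rewrite ffunE -/s.
transitivity (\sum_I \sum_L minor G K I * minor (invmx G) I L * b L).
  apply: eq_bigr => I _; rewrite ffunE finset.setCK -/s.
  have -> (x y : R) : x / s * (x * s * y) = x * x * (s^-1 * s) * y by ring.
  rewrite shuffle_sign_sqr mulVf// !mul1r mulr_sumr.
  by apply: eq_bigr => L _; rewrite mulrA.
rewrite exchange_big/= (bigD1 K)//= [X in _ + X]big1 ?addr0; last first.
  move=> L LK; rewrite -mulr_suml minor_mulmx// mulmxV// minor1//.
  by rewrite eq_sym (negPf LK) mul0r.
by rewrite -mulr_suml minor_mulmx// mulmxV// minor1// eqxx mul1r.
Qed.

Lemma hodge_inverseK : cancel (hodge_inverse G o) (hodge G o).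
Proof.
move=> a; apply/ffunP => J; rewrite ffunE -/s.
have -> : \sum_K gram G (~: J) K * hodge_inverse G o a K =
    \sum_I minor 1%:M (~: J) I * (shuffle_sign I (~: I) / s * a (~: I)).
  under eq_bigr => K _ do rewrite ffunE mulr_sumr.
  rewrite exchange_big/=; apply: eq_bigr => I _.
  under eq_bigr => K _ do rewrite mulrA gram_minor.
  by rewrite -mulr_suml minor_mulmx// mulVmx.
rewrite (bigD1 (~: J))//= [X in _ + X]big1 ?addr0; last first.
  by move=> I IJ; rewrite minor1// eq_sym (negPf IJ) mul0r.
rewrite minor1// eqxx mul1r finset.setCK.
have -> (x y : R) : x * s * (x / s * y) = x * x * (s / s) * y by ring.
by rewrite shuffle_sign_sqr mulfV// !mul1r.
Qed.

(** Replaces the inverse obtained by choice by a formula whose smoothness in the metric can be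
    checked coefficient by coefficient. *)
Lemma hodge_invE : hodge_inv G o = hodge_inverse G o.
Proof.
apply/funext => a; rewrite /hodge_inv -{1}[a]hodge_inverseK.
rewrite pinvKV ?inE//. 
exact: in2W (can_inj hodgeK).
Qed.

End fixed_metric.
End hodge_inverse.

(** * Calculus of functions of class C^m *)

Section directional_derivatives.
Context {R : realType} {V : normedModType R}.
Implicit Types (f : V -> R) (x v : V).

(** The two difference quotients are the same function of [h]. This transfers the chain rule and the
    mean value theorem from one real variable to directional derivatives. *)
Lemma line_derivable f x v (t : R) :
  derivable (fun s : R => f (x + s *: v)) t 1 <-> derivable f (x + t *: v) v.
Proof.
rewrite /derivable.
suff -> : (fun h : R => h^-1 *: (((fun s : R => f (x + s *: v)) \o shift t) (h *: 1)
   - f (x + t *: v))) = (fun h : R => h^-1 *: ((f \o shift (x + t *: v)) (h *: v)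
   - f (x + t *: v))) by [].
by apply/funext => h /=; rewrite scaler1 scalerDl addrCA.
Qed.

Lemma line_derive f x v (t : R) :
  'D_1 (fun s : R => f (x + s *: v)) t = 'D_v f (x + t *: v).
Proof.
rewrite /derive.
suff -> : (fun h : R => h^-1 *: (((fun s : R => f (x + s *: v)) \o shift t) (h *: 1)
   - f (x + t *: v))) = (fun h : R => h^-1 *: ((f \o shift (x + t *: v)) (h *: v)
   - f (x + t *: v))) by [].
by apply/funext => h /=; rewrite scaler1 scalerDl addrCA.
Qed.

Lemma is_derive_line f x v (t a : R) :
  is_derive t 1 (fun s : R => f (x + s *: v)) a <-> is_derive (x + t *: v) v f a.
Proof.
split=> -[df da]; apply: DeriveDef.
- exact/line_derivable.
- by rewrite -line_derive.
- exact/line_derivable.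
- by rewrite line_derive.
Qed.

Lemma is_derive_line0 f x v (a : R) :
  is_derive (0 : R) 1 (fun s : R => f (x + s *: v)) a <-> is_derive x v f a.
Proof. by rewrite is_derive_line scale0r addr0. Qed.

Lemma is_derive_translate f x c v (a : R) :
  is_derive (x + c) v f a -> is_derive x v (fun y => f (y + c)) a.
Proof.
move=> /is_derive_line0 df; apply/is_derive_line0.
by under eq_fun do rewrite addrAC.
Qed.

End directional_derivatives.

Section Ck_calculus.
Context {R : realType} {n : nat}.
Variable U : set 'rV[R]_n.
Hypothesis Uopen : open U.
Implicit Types (f g : 'rV[R]_n -> R) (x : 'rV[R]_n) (m : nat) (i j : 'I_n).

Lemma near_open x : U x -> \forall y \near x, U y.
Proof. by move=> Ux; exact: open_nbhs_nbhs. Qed.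

Lemma near_open_eq f g x : (forall y, U y -> f y = g y) -> U x ->
  \forall y \near x, f y = g y.
Proof. by move=> fg /near_open; apply: filterS. Qed.

Lemma eq_continuous f g x : (forall y, U y -> f y = g y) -> U x ->
  {for x, continuous f} -> {for x, continuous g}.
Proof.
move=> fg Ux cf; rewrite /prop_for /continuous_at -(fg x Ux).
exact: cvg_trans (near_eq_cvg (near_open_eq fg Ux)) cf.
Qed.

Lemma eq_derivable f g x v : (forall y, U y -> f y = g y) -> U x ->
  derivable f x v -> derivable g x v.
Proof. by move=> fg /(near_open_eq fg); exact: near_eq_derivable. Qed.

Lemma eq_partial f g x i : (forall y, U y -> f y = g y) -> U x ->
  partial i f x = partial i g x.
Proof. by move=> fg /(near_open_eq fg); exact: near_eq_derive. Qed.

(** Rules of differentiation give a partial derivative on [U] only; as [U] is open, this is enough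
    to substitute them in the inductions on [m] below. *)
Lemma eq_Ck m f g : (forall y, U y -> f y = g y) -> Ck m U f -> Ck m U g.
Proof.
elim: m f g => [|m IHm] f g fg [cf df].
  by split=> // x Ux; apply: eq_continuous Ux (cf x Ux).
split=> [x Ux|i]; first exact: eq_continuous Ux (cf x Ux).
have [dfi ckf] := df i; split=> [x Ux|]; first exact: eq_derivable Ux (dfi x Ux).
by apply: IHm ckf => x Ux; exact: eq_partial.
Qed.

Lemma Ck_continuous m f x : Ck m U f -> U x -> {for x, continuous f}.
Proof. by case: m => [|m] [+ _]; exact. Qed.

Lemma Ck_derivable m f x i : Ck m.+1 U f -> U x ->
  derivable f x (delta_mx ord0 i).
Proof. by move=> [_ /(_ i)[+ _]]; exact. Qed.

Lemma Ck_is_derive m f x i : Ck m.+1 U f -> U x ->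
  is_derive x (delta_mx ord0 i) f (partial i f x).
Proof. by move=> Cf Ux; apply: DeriveDef; first exact: Ck_derivable Cf Ux. Qed.

Lemma Ck_partial m f i : Ck m.+1 U f -> Ck m U (partial i f).
Proof. by move=> [_ /(_ i)[]]. Qed.

Arguments Ck_derivable {m f x} i _ _.
Arguments Ck_partial {m f} i _.

Lemma CkW m f : Ck m.+1 U f -> Ck m U f.
Proof.
elim: m f => [|m IHm] f [cf df]; first by [].
by split=> // i; have [dfi ckf] := df i; split=> //; exact: IHm.
Qed.

Lemma Ck_cst m (a : R) : Ck m U (fun=> a).
Proof.
elim: m a => [|m IHm] a; first by split=> // x _; exact: cst_continuous.
split=> [x _|i]; first exact: cst_continuous.
split=> [x _|]; first exact: derivable_cst.
apply: eq_Ck (IHm 0) => x _; rewrite /partial.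
by rewrite [LHS](_ : _ = 'D_(delta_mx ord0 i) (cst a) x) // derive_cst.
Qed.

Lemma CkD m f g : Ck m U f -> Ck m U g -> Ck m U (fun x => f x + g x).
Proof.
elim: m f g => [|m IHm] f g Cf Cg.
  by split=> // x Ux; exact: cvgD (Ck_continuous Cf Ux) (Ck_continuous Cg Ux).
split=> [x Ux|i].
  exact: cvgD (Ck_continuous Cf Ux) (Ck_continuous Cg Ux).
split=> [x Ux|].
  by have := derivableD (Ck_derivable i Cf Ux) (Ck_derivable i Cg Ux).
apply: eq_Ck (IHm _ _ (Ck_partial i Cf) (Ck_partial i Cg)) => x Ux.
by have := deriveD (Ck_derivable i Cf Ux) (Ck_derivable i Cg Ux).
Qed.

Lemma CkM m f g : Ck m U f -> Ck m U g -> Ck m U (fun x => f x * g x).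
Proof.
elim: m f g => [|m IHm] f g Cf Cg.
  by split=> // x Ux; exact: cvgM (Ck_continuous Cf Ux) (Ck_continuous Cg Ux).
split=> [x Ux|i].
  exact: cvgM (Ck_continuous Cf Ux) (Ck_continuous Cg Ux).
split=> [x Ux|].
  by have := derivableM (Ck_derivable i Cf Ux) (Ck_derivable i Cg Ux).
have CfDg := IHm _ _ (CkW Cf) (Ck_partial i Cg).
have CgDf := IHm _ _ (CkW Cg) (Ck_partial i Cf).
apply: eq_Ck (CkD CfDg CgDf) => x Ux.
by have := deriveM (Ck_derivable i Cf Ux) (Ck_derivable i Cg Ux).
Qed.

Lemma CkZ m (a : R) f : Ck m U f -> Ck m U (fun x => a * f x).
Proof. by move=> Cf; exact: CkM (Ck_cst m a) Cf. Qed.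

Lemma Ck_sum m (I : Type) (r : seq I) (P : pred I) (F : I -> 'rV[R]_n -> R) :
  (forall a, P a -> Ck m U (F a)) -> Ck m U (fun x => \sum_(a <- r | P a) F a x).
Proof.
move=> CF; elim: r => [|a r IHr].
  by apply: eq_Ck (Ck_cst m 0) => x _; rewrite big_nil.
case Pa : (P a); last by apply: eq_Ck IHr => x _; rewrite big_cons Pa.
by apply: eq_Ck (CkD (CF _ Pa) IHr) => x _; rewrite big_cons Pa.
Qed.

Lemma Ck_prod m (I : Type) (r : seq I) (P : pred I) (F : I -> 'rV[R]_n -> R) :
  (forall a, P a -> Ck m U (F a)) ->
  Ck m U (fun x => \prod_(a <- r | P a) F a x).
Proof.
move=> CF; elim: r => [|a r IHr].
  by apply: eq_Ck (Ck_cst m 1) => x _; rewrite big_nil.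
case Pa : (P a); last by apply: eq_Ck IHr => x _; rewrite big_cons Pa.
by apply: eq_Ck (CkM (CF _ Pa) IHr) => x _; rewrite big_cons Pa.
Qed.

Lemma CkV m f : (forall x, U x -> f x != 0) -> Ck m U f ->
  Ck m U (fun x => (f x)^-1).
Proof.
move=> f0; elim: m f f0 => [|m IHm] f f0 Cf.
  by split=> // x Ux; apply: cvgV (Ck_continuous Cf Ux); exact: f0.
split=> [x Ux|i].
  by apply: cvgV (Ck_continuous Cf Ux); exact: f0.
split=> [x Ux|].
  by apply: derivableV (Ck_derivable i Cf Ux); exact: f0.
have CV := IHm _ f0 (CkW Cf).
apply: eq_Ck (CkM (CkZ (-1) (CkM CV CV)) (Ck_partial i Cf)) => x Ux.
rewrite /partial deriveV ?f0//; last exact: Ck_derivable Cf Ux.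
by rewrite /GRing.scale/= expr2 mulN1r -invfM.
Qed.

Lemma is_derive_sqrt_comp f x v : 0 < f x -> derivable f x v ->
  is_derive x v (fun y => Num.sqrt (f y)) ((2 * Num.sqrt (f x))^-1 * 'D_v f x).
Proof.
move=> fx0 /derivableP /is_derive_line0 df.
apply/(is_derive_line0 (fun y => Num.sqrt (f y)) x v).
have := @is_derive1_comp _ Num.sqrt (fun s => f (x + s *: v)) 0 (2 * Num.sqrt (f x))^-1 ('D_v f x).
by apply => //; rewrite scale0r addr0; exact: is_derive1_sqrt.
Qed.

Lemma Ck_sqrt m f : (forall x, U x -> 0 < f x) -> Ck m U f ->
  Ck m U (fun x => Num.sqrt (f x)).
Proof.
move=> f0; have csqrt x : U x -> {for x, continuous f} ->
    {for x, continuous (fun x => Num.sqrt (f x))}.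
  by move=> Ux cf; apply: continuous_comp cf _; exact: sqrt_continuous.
elim: m f f0 csqrt => [|m IHm] f f0 csqrt Cf.
  by split=> // x Ux; apply: csqrt (Ck_continuous Cf Ux).
split=> [x Ux|i]; first by apply: csqrt (Ck_continuous Cf Ux).
have dsqrt x : U x -> is_derive x (delta_mx ord0 i) (fun y => Num.sqrt (f y))
    ((2 * Num.sqrt (f x))^-1 * partial i f x).
  by move=> Ux; apply: is_derive_sqrt_comp; [exact: f0|exact: Ck_derivable Cf Ux].
split=> [x Ux|]; first by have [] := dsqrt x Ux.
have CS := IHm _ f0 csqrt (CkW Cf).
apply: eq_Ck (CkM (CkV _ (CkZ 2 CS)) (Ck_partial i Cf)) => x Ux.
  by rewrite [in RHS]/partial; have [_ ->] := dsqrt x Ux.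
by rewrite mulf_neq0// sqrtr_eq0 -ltNge f0.
Qed.

Lemma is_derive_coord x v j : is_derive x v (fun y : 'rV[R]_n => y ord0 j) (v ord0 j).
Proof.
apply/(is_derive_line0 (fun y : 'rV[R]_n => y ord0 j) x v).
suff -> : (fun s : R => (x + s *: v) ord0 j) = (fun s => x ord0 j + s * v ord0 j).
  suff -> : (fun s : R => x ord0 j + s * v ord0 j) =
      cst (x ord0 j) + v ord0 j *: id.
    have d1 : is_derive (0 : R) 1 (cst (x ord0 j)) 0 by exact: is_derive_cst.
    have d2 : is_derive (0 : R) 1 id 1 by exact: is_derive_id.
    have := is_deriveD d1 (is_deriveZ (v ord0 j) d2).
    by rewrite add0r /GRing.scale/= mulr1.
  by apply/funext => s; rewrite !fctE /GRing.scale/= [s * _]mulrC.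
by apply/funext => s; rewrite !mxE.
Qed.

Lemma Ck_coord m j : Ck m U (fun x => x ord0 j).
Proof.
case: m => [|m]; first by split=> // x _; exact: coord_continuous.
split=> [x _|i]; first exact: coord_continuous.
split=> [x _|]; first by have [] := is_derive_coord x (delta_mx ord0 i) j.
apply: eq_Ck (Ck_cst m ((delta_mx ord0 i : 'rV[R]_n) ord0 j)) => x _.
by rewrite /partial; have [_ ->] := is_derive_coord x (delta_mx ord0 i) j.
Qed.

Lemma Ck_det m p (A : 'rV[R]_n -> 'M[R]_p) :
  (forall a b, Ck m U (fun x => A x a b)) -> Ck m U (fun x => \det (A x)).
Proof.
move=> CA; apply: Ck_sum => s _; apply: CkZ; apply: Ck_prod => i _; exact: CA.
Qed.

(** Cramer's rule: an entry of the inverse is a cofactor, polynomial in the entries of [A x],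
    divided by the determinant. *)
Lemma Ck_invmx m p (A : 'rV[R]_n -> 'M[R]_p) (i j : 'I_p) :
  (forall x, U x -> A x \in unitmx) ->
  (forall a b, Ck m U (fun x => A x a b)) -> Ck m U (fun x => invmx (A x) i j).
Proof.
move=> uA CA.
have CC : Ck m U (fun x => cofactor (A x) j i).
  apply: CkZ; apply: Ck_det => k l.
  by apply: eq_Ck (CA (lift j k) (lift i l)) => x _; rewrite !mxE.
have CD : Ck m U (fun x => (\det (A x))^-1).
  by apply: CkV (Ck_det CA) => x /uA; rewrite unitmxE unitfE.
by apply: eq_Ck (CkM CD CC) => x /uA uAx; rewrite /invmx uAx !mxE.
Qed.

End Ck_calculus.

Section mean_value.
Context {R : realType} {V : normedModType R}.
Implicit Types (f : V -> R) (x v : V).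

(** Absolute values cover increments of either sign, and the non-strict bound on [s] includes
    [t = 0]. *)
Lemma line_MVT f x v (t : R) :
  (forall s : R, `|s| <= `|t| -> derivable f (x + s *: v) v) ->
  exists2 s : R, `|s| <= `|t| & f (x + t *: v) - f x = t * 'D_v f (x + s *: v).
Proof.
move=> df; pose phi (s : R) := f (x + s *: v).
have dphi (s : R) : `|s| <= `|t| -> is_derive s 1 phi ('D_v f (x + s *: v)).
  by move=> st; apply/is_derive_line; exact/derivableP/df.
have cphi (s : R) : `|s| <= `|t| -> {for s, continuous phi}.
  by move=> /dphi[ds _]; exact/differentiable_continuous/derivable1_diffP.
have [t0|t0|t0] := ltgtP 0 t.
- have tn s : s \in `[0, t] -> `|s| <= `|t|.
    by rewrite in_itv/= => /andP[s0 st]; rewrite !ger0_norm// ltW.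
  have := @MVT _ phi (fun s => 'D_v f (x + s *: v)) 0 t t0.
  case=> [s sI|s|s sI E].
  + by apply: dphi; apply: tn; exact: subset_itv_oo_cc.
  + apply: continuous_in_subspaceT => y; rewrite inE/= => yI.
    by apply: cphi; exact: tn.
  + exists s; first by apply: tn; exact: subset_itv_oo_cc.
    by move: E; rewrite /phi scale0r addr0 subr0 mulrC.
- have tn s : s \in `[t, 0] -> `|s| <= `|t|.
    rewrite in_itv/= => /andP[s0 st].
    by rewrite !ler0_norm ?lerN2// ltW.
  have := @MVT _ phi (fun s => 'D_v f (x + s *: v)) t 0 t0.
  case=> [s sI|s|s sI E].
  + by apply: dphi; apply: tn; exact: subset_itv_oo_cc.
  + apply: continuous_in_subspaceT => y; rewrite inE/= => yI.
    by apply: cphi; exact: tn.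
  + exists s; first by apply: tn; exact: subset_itv_oo_cc.
    move: E; rewrite /phi scale0r addr0 sub0r => E.
    by rewrite -opprB E mulrN opprK mulrC.
- by exists 0; rewrite -t0 ?normr0// scale0r addr0 subrr mul0r.
Qed.

End mean_value.

(** * Consequences of the continuity of partial derivatives *)

Section continuously_differentiable.
Context {R : realType} {n : nat}.
Variable U : set 'rV[R]_n.
Hypothesis Uopen : open U.
Implicit Types (f g : 'rV[R]_n -> R) (x : 'rV[R]_n) (i j : 'I_n).
Local Notation e i := (delta_mx ord0 i : 'rV[R]_n).

Lemma norm_delta_mx_le i : `|e i| <= 1.
Proof.
rewrite [leLHS]mx_normrE; apply/bigmax_leP; split=> // -[a b] _ /=.
by rewrite mxE; case: (_ && _); rewrite ?normr1 ?normr0.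
Qed.

(* The mean value theorem in both directions: the symmetry of the left-hand
   side in i and j gives the symmetry of second derivatives. *)
Lemma second_difference f x i j : Ck 2 U f -> U x -> \forall d \near (0 : R)^'+,
  forall t : R, 0 < t -> 2 * t < d -> exists2 y, `|y - x| < d &
    f (x + t *: e i + t *: e j) - f (x + t *: e i) - (f (x + t *: e j) - f x) =
      t * t * partial i (partial j f) y.
Proof.
move=> Cf Ux.
have /nbhs_ballP[d0 /= d0_gt0 d0U] := near_open Uopen Ux.
near=> d => t t0 td.
have inU (a b : R) : `|a| <= t -> `|b| <= t ->
    `|x + a *: e i + b *: e j - x| < d.
  move=> at_ bt; rewrite addrAC [x + _]addrC addrK.
  rewrite (le_lt_trans (ler_normD _ _))// !normrZ (le_lt_trans _ td)//.
  rewrite mulr2n mulrDl !mul1r lerD//.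
    by rewrite -[leRHS]mulr1 ler_pM// norm_delta_mx_le.
  by rewrite -[leRHS]mulr1 ler_pM// norm_delta_mx_le.
have dU y : `|y - x| < d -> U y.
  move=> yx; apply: d0U; rewrite -ball_normE/= distrC (lt_trans yx)//.
have t_norm : `|t| = t by rewrite ger0_norm// ltW.
pose phi y := f (y + t *: e i) - f y.
have dphi s : `|s| <= `|t| -> is_derive (x + s *: e j) (e j) phi
    (partial j f (x + s *: e j + t *: e i) - partial j f (x + s *: e j)).
  rewrite t_norm => st; apply: is_deriveB.
    apply: (is_derive_translate (f := f) (c := t *: e i)).
    apply: (Ck_is_derive j Cf); apply: dU.
    by have := inU t s; rewrite [x + _ + _]addrAC t_norm; exact.
  apply: (Ck_is_derive j Cf); apply: dU.
  by have := inU 0 s; rewrite scale0r addr0; apply; rewrite // normr0 ltW.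
have [|s st] := @line_MVT _ _ phi x (e j) t; first by move=> s /dphi[].
have [_ ->] := dphi s st; rewrite t_norm in st => E.
have [|s' s't E'] := @line_MVT _ _ (partial j f) (x + s *: e j) (e i) t.
  rewrite t_norm => s' s't; apply: Ck_derivable (Ck_partial j Cf) _; apply: dU.
  by rewrite [x + _ + _]addrAC; exact: inU.
exists (x + s *: e j + s' *: e i).
  by rewrite [x + _ + _]addrAC; apply: inU => //; rewrite -t_norm.
by rewrite -mulrA -E' -E /phi [x + _ + _]addrAC; ring.
Unshelve. all: by end_near. Qed.

(** The second difference is symmetric, so the two mixed derivatives agree at points [y] and [z]
    near [x], which may differ; continuity of both derivatives at [x] costs [eps / 2] each. *)
Lemma schwarz f x i j : Ck 2 U f -> U x ->
  partial i (partial j f) x = partial j (partial i f) x.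
Proof.
move=> Cf Ux; apply/eqP; rewrite -subr_eq0 -normr_le0.
apply/ler_addgt0Pr => eps eps0; rewrite add0r.
have e20 : 0 < eps / 2 by rewrite divr_gt0.
have cont k l : \forall d \near (0 : R)^'+, forall y, `|y - x| < d ->
    `|partial k (partial l f) x - partial k (partial l f) y| < eps / 2.
  have := Ck_continuous (Ck_partial k (Ck_partial l Cf)) Ux.
  move=> /cvgrPdist_lt/(_ _ e20)/nbhs_ballP[d /= d0 dP].
  near=> d1 => y yx; apply: dP; rewrite -ball_normE/= distrC (lt_trans yx)//.
have [d [dgt0 [Sij [Sji [cij cji]]]]] := filter_ex (filterI (nbhs_right_gt 0)
  (filterI (second_difference i j Cf Ux)
    (filterI (second_difference j i Cf Ux) (filterI (cont i j) (cont j i))))).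
(* Any positive [t] below [d / 2] would do. *)
pose t := d / 3.
have t0 : 0 < t by rewrite divr_gt0.
have td : 2 * t < d by rewrite /t; lra.
have [y /cij yx yE] := Sij t t0 td.
have [z /cji zx zE] := Sji t t0 td.
have yz : t * t * partial i (partial j f) y = t * t * partial j (partial i f) z.
  apply: etrans (etrans (esym yE) _) zE; rewrite [x + t *: e j + _]addrAC.
  by move: (f _) (f _) (f _) (f _) => *; ring.
have {}yz := mulfI (lt0r_neq0 (mulr_gt0 t0 t0)) yz.
rewrite yz in yx; move: yx zx.
move: (partial _ _ z) (partial _ _ x) (partial _ _ x) => p q q' qp q'p.
clear -qp q'p.
rewrite (splitr eps) (le_trans (ler_distD p _ _))// lerD ?ltW//.
by rewrite distrC.
Unshelve. all: by end_near. Qed.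

(** Allows the coordinate directions to be added one at a time. The quotient along [u + b *: e i] is
    the one along [u] plus one along [e i] based at the moving point [h *: u + x]; the mean value
    theorem turns the latter into [b] times a value of [partial i f] near [x]. *)
Lemma is_derive_add_partial f x u (a b : R) i : Ck 1 U f -> U x ->
  is_derive x u f a -> is_derive x (u + b *: e i) f (a + b * partial i f x).
Proof.
move=> Cf Ux [du dua].
have cvu : h^-1 *: (f (h *: u + x) - f x) @[h --> 0^'] --> a.
  by rewrite -dua; exact: du.
suff cvb : h^-1 *: (f (h *: (u + b *: e i) + x) - f (h *: u + x)) @[h --> 0^']
    --> b * partial i f x.
  have cv : h^-1 *: (f (h *: (u + b *: e i) + x) - f x) @[h --> 0^']
      --> a + b * partial i f x.
    rewrite [a + _]addrC; apply: cvg_trans (cvgD cvb cvu); apply: near_eq_cvg.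
    by near=> h; rewrite -[LHS]scalerDr addrA subrK.
  by apply: DeriveDef; [apply: cvgP cv|apply: cvg_lim cv].
apply/cvgrPdist_le => eps eps0.
(* Chosen so that [|b| * c <= eps]; the 1 keeps the denominator positive when [b = 0]. *)
pose c := eps / (1 + `|b|).
have c0 : 0 < c by rewrite divr_gt0// ltr_wpDr.
have /cvgrPdist_lt/(_ _ c0) := Ck_continuous (Ck_partial i Cf) Ux.
move=> /nbhs_ballP[d1 /= d10 d1P].
have /nbhs_ballP[d2 /= d20 d2U] := near_open Uopen Ux.
have u1 : 0 < `|u| + `|b| + 1 by rewrite ltr_wpDl// addr_ge0.
near=> h.
have h0 : h != 0 by near: h; exact: nbhs_dnbhs_neq.
(* The intermediate points are within [|h| * (|u| + |b|)] of [x]; the added 1 makes the factor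
   positive, so that one can divide by it. *)
have hd : `|h| * (`|u| + `|b| + 1) < Num.min d1 d2.
  rewrite -ltr_pdivlMr//; near: h; apply: dnbhs0_lt.
  by rewrite divr_gt0// lt_min d10.
have near_x s : `|s| <= `|h * b| -> `|x - (h *: u + x + s *: e i)| < Num.min d1 d2.
  move=> sb; apply: le_lt_trans hd.
  have -> : x - (h *: u + x + s *: e i) = - (h *: u + s *: e i).
    by rewrite [h *: u + x]addrC -addrA opprD addrA subrr sub0r.
  rewrite normrN.
  rewrite (le_trans (ler_normD _ _))// !normrZ -addrA mulrDr lerD//.
  rewrite (@le_trans _ _ (`|h * b|))//; last first.
    by rewrite normrM ler_wpM2l// lerDl.
  by rewrite -[leRHS]mulr1 ler_pM// norm_delta_mx_le.
have [s sb] : exists2 s : R, `|s| <= `|h * b| &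
   f (h *: u + x + (h * b) *: e i) - f (h *: u + x) =
     (h * b) * 'D_(e i) f (h *: u + x + s *: e i).
  apply: line_MVT => s sb; apply: Ck_derivable Cf _; apply: d2U.
  by rewrite -ball_normE/=; have := near_x s sb; rewrite lt_min => /andP[].
rewrite -/(partial i f _) => E.
rewrite [h *: (u + _) + x](_ : _ = h *: u + x + (h * b) *: e i); last first.
  by rewrite scalerDr scalerA addrAC.
rewrite E [X in _ - X](_ : _ = b * partial i f (h *: u + x + s *: e i)); last first.
  by rewrite /GRing.scale/= mulrA mulKf.
rewrite -mulrBr normrM.
have : `|partial i f x - partial i f (h *: u + x + s *: e i)| <= c.
  apply/ltW/d1P; rewrite -ball_normE/=.
  by have := near_x s sb; rewrite lt_min => /andP[].
move=> /(ler_wpM2l (normr_ge0 b)) /le_trans; apply.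
rewrite /c mulrCA ler_piMr ?(ltW eps0)// ler_pdivrMr ?ltr_wpDr//.
by rewrite mul1r lerDr.
Unshelve. all: by end_near. Qed.

Lemma is_derive_sum_partial f x v : Ck 1 U f -> U x ->
  is_derive x v f (\sum_i v ord0 i * partial i f x).
Proof.
move=> Cf Ux; rewrite [v in is_derive _ v](row_sum_delta v).
elim: (index_enum _) => [|i r IHr]; first by rewrite !big_nil; exact: is_derive0.
rewrite !big_cons addrC [X in is_derive _ _ _ X]addrC.
exact: is_derive_add_partial.
Qed.

End continuously_differentiable.

(** * Radial integrals *)

Section radial_integral.
Context {R : realType} {n : nat}.
Variables (U : set 'rV[R]_n) (x0 : 'rV[R]_n).
Hypothesis Uopen : open U.
Hypothesis Ustar : forall x, U x -> exists K : set 'rV[R]_n,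
  [/\ compact K, K `<=` U, nbhs x K &
      forall y (t : R), K y -> 0 <= t <= 1 -> K (x0 + t *: (y - x0))].
Implicit Types (f : 'rV[R]_n -> R) (x y v : 'rV[R]_n) (t : R) (i : 'I_n) (p : nat).
Local Notation e i := (delta_mx ord0 i : 'rV[R]_n).

(** The exponent [p] is a parameter because each differentiation in [x] under the integral sign
    raises it by one. *)
Definition radial_integral p f x : R :=
  (\int[lebesgue_measure]_(t in `[0%R, 1%R]) (f (x0 + t *: (x - x0)) * t ^+ p))%R.

Lemma star_segment x t : U x -> 0 <= t <= 1 -> U (x0 + t *: (x - x0)).
Proof.
move=> /Ustar[K [_ KU xK Kstar]] t01; apply/KU/Kstar => //.
exact: nbhs_singleton.
Qed.

(** The bound of [f] on the compact [K] of [Ustar]: [K] contains the segments from [x0] to all of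
    its points, hence to all points near [x]. *)
Lemma star_bounded m f x : Ck m U f -> U x -> exists2 M, 0 <= M &
  \forall y \near x, forall t, 0 <= t <= 1 -> U (x0 + t *: (y - x0)) /\
    `|f (x0 + t *: (y - x0))| <= M.
Proof.
move=> Cf /Ustar[K [Kc KU xK Kstar]].
have : compact (f @` K).
  apply: continuous_compact Kc; apply: continuous_in_subspaceT => y.
  by rewrite inE => /KU; exact: Ck_continuous Cf.
move=> /compact_bounded[M [_ /(_ (`|M| + 1)) fM]].
(* [compact_bounded] gives a bound by every number strictly above [M]; this one is also
   nonnegative. *)
exists (`|M| + 1); first by rewrite addr_ge0.
apply: filterS xK => y Ky t t01; have Kyt := Kstar y t Ky t01.
split; first exact: KU.
by apply: fM; [rewrite (le_lt_trans (ler_norm _))// ltrDl|exists (x0 + t *: (y - x0))].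
Qed.

Lemma line_shift x v t : x0 + t *: (x + v - x0) = x0 + t *: (x - x0) + t *: v.
Proof. by rewrite addrAC scalerDr addrA. Qed.

Lemma continuous_segment (x v : 'rV[R]_n) : continuous (fun t : R => x + t *: v).
Proof.
move=> t; apply: cvgD; first exact: cvg_cst.
by apply: cvgZr_tmp; exact: cvg_id.
Qed.

Lemma continuous_at_integrand m p f x t : Ck m U f -> U x -> 0 <= t <= 1 ->
  {for t, continuous (fun t : R => f (x0 + t *: (x - x0)) * t ^+ p)}.
Proof.
move=> Cf Ux t01; apply: cvgM; last exact: exprn_continuous.
apply: continuous_comp; first exact: continuous_segment.
by apply: Ck_continuous Cf _; exact: star_segment.
Qed.

Lemma continuous_integrand m p f x : Ck m U f -> U x ->
  {within `[0, 1]%classic, continuous (fun t : R => f (x0 + t *: (x - x0)) * t ^+ p)}.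
Proof.
move=> Cf Ux; apply: continuous_in_subspaceT => t.
by rewrite inE/= in_itv/= => t01; exact: continuous_at_integrand Cf Ux t01.
Qed.

Lemma integrable_integrand m p f x : Ck m U f -> U x ->
  lebesgue_measure.-integrable `[0, 1]%classic
    (EFin \o (fun t : R => f (x0 + t *: (x - x0)) * t ^+ p)).
Proof.
move=> Cf Ux; apply: continuous_compact_integrable; first exact: segment_compact.
exact: continuous_integrand Cf Ux.
Qed.

Lemma radial_integral_sum m p (I : Type) (r : seq I) (a : I -> R)
    (F : I -> 'rV[R]_n -> R) x : (forall k, Ck m U (F k)) -> U x ->
  radial_integral p (fun y => \sum_(k <- r) a k * F k y) x =
  \sum_(k <- r) a k * radial_integral p (F k) x.
Proof.
move=> CF Ux; elim: r => [|k r IHr].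
  rewrite big_nil; under [LHS]eq_Rintegral => t _ do rewrite big_nil mul0r.
  by rewrite Rintegral_cst// mul0r.
rewrite big_cons -IHr -RintegralZl//; last exact: integrable_integrand (CF k) Ux.
rewrite -RintegralD//.
- by apply: eq_Rintegral => t _; rewrite big_cons mulrDl mulrA.
- have := integrable_integrand p (CkZ Uopen (a k) (CF k)) Ux.
  by apply: eq_integrable => // t _ /=; rewrite mulrA.
- have CS : Ck m U (fun y => \sum_(k <- r) a k * F k y).
    by apply: Ck_sum => // l _; exact: CkZ.
  exact: integrable_integrand CS Ux.
Qed.

Lemma radial_integral_eq p f g x : U x -> (forall y, U y -> f y = g y) ->
  radial_integral p f x = radial_integral p g x.
Proof.
move=> Ux fg; apply: eq_Rintegral => t; rewrite inE/= in_itv/= => t01.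
by rewrite fg//; exact: star_segment.
Qed.

Lemma integrable_cst01 (M : R) :
  lebesgue_measure.-integrable `[0 : R, 1]%classic (EFin \o cst M).
Proof.
apply: continuous_compact_integrable; first exact: segment_compact.
by apply: continuous_subspaceT => t; exact: cst_continuous.
Qed.

Lemma ler_norm_mul_exprn p (a M t : R) : 0 <= t <= 1 -> `|a| <= M ->
  `|a * t ^+ p| <= M.
Proof.
move=> /andP[t0 t1] aM; rewrite normrM normrX (ger0_norm t0).
by rewrite -[leRHS]mulr1 ler_pM// ?exprn_ge0//; exact: exprn_ile1.
Qed.

Lemma le_radial_integral m p f x (M : R) : Ck m U f -> U x ->
  (forall t, 0 <= t <= 1 -> `|f (x0 + t *: (x - x0))| <= M) ->
  `|radial_integral p f x| <= M.
Proof.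
move=> Cf Ux fM; have intf := integrable_integrand p Cf Ux.
apply: le_trans (le_normr_Rintegral _ intf) _ => //.
apply: (@le_trans _ _ (\int[lebesgue_measure]_(t in `[0%R, 1%R]) (cst M t))%R).
  apply: le_Rintegral => //; last 1 first.
  - move=> t; rewrite /= in_itv/= => t01.
    by apply: ler_norm_mul_exprn => //; exact: fM.
  - exact: integrable_norm intf.
  - exact: integrable_cst01.
have m01 : lebesgue_measure (`[0, 1]%classic : set R) = 1%E.
  by rewrite lebesgue_measure_itv/= lte_fin ltr01 -EFinB subr0.
by rewrite Rintegral_cst//= [X in fine X]m01 mulr1.
Qed.

Let dir v f y := \sum_i v ord0 i * partial i f y.

(** Differentiation under the integral sign in the single variable [s] of [x + s *: v], dominated by
    the constant of [star_bounded]. The chain rule yields the extra factor [t]. An arbitrary [v] is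
    allowed because the proof of continuity differentiates along [y - x]. *)
Lemma is_derive_radial_integral_dir p f x v : Ck 1 U f -> U x ->
  is_derive x v (radial_integral p f)
    (\sum_i v ord0 i * radial_integral p.+1 (partial i f) x).
Proof.
move=> Cf Ux; apply/is_derive_line0.
have Cv : Ck 0 U (dir v f).
  by apply: Ck_sum => // i _; apply: CkZ => //; exact: Ck_partial Cf.
rewrite -(@radial_integral_sum 0 p.+1 _ _ (v ord0))//; last first.
  by move=> i; exact: Ck_partial Cf.
have [M M0 xM] := star_bounded Cv Ux.
have [d d0 dM] : exists2 d : R, 0 < d & forall s : R, `|s| < d ->
    U (x + s *: v) /\ forall t, 0 <= t <= 1 ->
      U (x0 + t *: (x + s *: v - x0)) /\
      `|dir v f (x0 + t *: (x + s *: v - x0))| <= M.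
  have := @continuous_segment x v 0; rewrite /continuous_at scale0r addr0.
  move=> /(_ _ (filterI (near_open Uopen Ux) xM)) /nbhs_ballP[d /= d0 dM].
  by exists d => // s sd; apply: dM; rewrite -ball_normE/= sub0r normrN.
pose F (s t : R) := f (x0 + t *: (x + s *: v - x0)) * t ^+ p.
have dF (s t : R) : `|s| < d -> 0 <= t <= 1 -> is_derive s 1 (F ^~ t)
    (dir v f (x0 + t *: (x + s *: v - x0)) * t ^+ p.+1).
  move=> sd t01; have [_ /(_ t t01)[Us _]] := dM s sd.
  suff df : is_derive s 1 (fun s : R => f (x0 + t *: (x + s *: v - x0)))
      (t * dir v f (x0 + t *: (x + s *: v - x0))).
    have := is_deriveM df (is_derive_cst (t ^+ p) s 1).
    rewrite scaler0 add0r /GRing.scale/=.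
    by move: (dir _ _ _) => a; rewrite (mulrA (t ^+ p)) -exprSr (mulrC _ a).
  have -> : (fun s : R => f (x0 + t *: (x + s *: v - x0))) =
      (fun s : R => f (x0 + t *: (x - x0) + s *: (t *: v))).
    by apply/funext => s'; rewrite line_shift !scalerA mulrC.
  apply/(is_derive_line f (x0 + t *: (x - x0)) (t *: v)); have := is_derive_sum_partial Uopen (t *: v) Cf Us.
  rewrite {1}line_shift !scalerA mulrC -scalerA => df.
  apply: is_derive_eq df _; rewrite /dir mulr_sumr.
  by apply: eq_bigr => i _; rewrite mxE mulrA.
have in_d (s : R) : `](- d), d[%classic s -> `|s| < d.
  by rewrite /= in_itv/= ltr_norml.
have in_01 (t : R) : `[0, 1]%classic t -> 0 <= t <= 1.
  by rewrite /= in_itv.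
have I0 : `](- d), d[%classic (0 : R) by rewrite /= in_itv/= oppr_lt0 d0.
have intF (s : R) : `](- d), d[%classic s ->
    lebesgue_measure.-integrable `[0, 1]%classic (EFin \o F s).
  by move=> /in_d/dM[Us _]; exact: integrable_integrand Cf Us.
have derF (s t : R) : `](- d), d[%classic s -> `[0, 1]%classic t ->
    derivable (F ^~ t) s 1.
  by move=> /in_d sd /in_01 t01; have [] := dF s t sd t01.
have leF (s t : R) : `](- d), d[%classic s -> `[0, 1]%classic t ->
    `|partial1of2 F s t| <= cst M t.
  move=> /in_d sd /in_01 t01; rewrite partial1of2E.
  have [_ ->] := dF s t sd t01; have [_ /(_ t t01)[_ leM]] := dM s sd.
  exact: ler_norm_mul_exprn.
have mI : measurable (`[0, 1]%classic : set (measurableTypeR R)) by [].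
have M_ge0 (t : R) : 0 <= cst M t by [].
apply: DeriveDef.
  exact: (derivable_under_integral mI I0 intF derF M_ge0 (integrable_cst01 M) leF).
have := differentiation_under_integral mI I0 intF derF M_ge0 (integrable_cst01 M) leF.
rewrite derive1E => ->; apply: eq_Rintegral => t; rewrite inE => /in_01 t01.
rewrite partial1of2E; have [_ ->] := dF 0 t (in_d _ I0) t01.
by rewrite scale0r addr0.
Qed.

Lemma is_derive_radial_integral p f x i : Ck 1 U f -> U x ->
  is_derive x (e i) (radial_integral p f) (radial_integral p.+1 (partial i f) x).
Proof.
move=> Cf Ux; apply: is_derive_eq (is_derive_radial_integral_dir p (e i) Cf Ux) _.
rewrite (bigD1 i)//= big1 ?addr0; first by rewrite !mxE !eqxx mul1r.
by move=> j ji; rewrite !mxE eqxx (negPf ji) mul0r.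
Qed.

(** The mean value theorem along [y - x] bounds the increment by the norm of [y - x] times a sum of
    local bounds for the partial derivatives. *)
Lemma radial_integral_continuous p f x : Ck 1 U f -> U x ->
  {for x, continuous (radial_integral p f)}.
Proof.
move=> Cf Ux; apply/(@cvgrPdist_le R R^o 'rV[R]_n (nbhs x)) => eps eps0.
have /choice[M MP] : forall i, exists M : R, 0 <= M /\ \forall y \near x,
    forall t, 0 <= t <= 1 -> U (x0 + t *: (y - x0)) /\
    `|partial i f (x0 + t *: (y - x0))| <= M.
  by move=> i; have [M M0 xM] := star_bounded (Ck_partial i Cf) Ux; exists M.
have M_ge0 : 0 <= \sum_i M i by apply: sumr_ge0 => i _; have [] := MP i.
have xM : \forall y \near x, U y /\ forall i t, 0 <= t <= 1 ->
    U (x0 + t *: (y - x0)) /\ `|partial i f (x0 + t *: (y - x0))| <= M i.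
  apply: filterI; first exact: near_open.
  exact: (filter_forall (nbhs_filter x) (fun i => (MP i).2)).
have /nbhs_ballP[d /= d0 dM] := xM.
near=> y.
have yd : `|y - x| < d.
  near: y; apply/nbhs_ballP; exists d => //= y.
  by rewrite -ball_normE/= distrC.
(* The added 1 keeps the divisor positive even if all the bounds [M i] are 0. *)
have yeps : `|y - x| * (\sum_i M i + 1) <= eps.
  rewrite -ler_pdivlMr ?ltr_wpDl//; near: y.
  apply/nbhs_ballP; exists (eps / (\sum_i M i + 1)) => [|y] /=.
    by rewrite divr_gt0// ltr_wpDl.
  by rewrite -ball_normE/= distrC => /ltW.
have ball_s (s : R) : `|s| <= `|1 : R| -> `|s *: (y - x)| < d.
  rewrite normr1 => s1; rewrite normrZ (le_lt_trans _ yd)//.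
  by rewrite -[leRHS]mul1r ler_wpM2r.
have inball (s : R) : `|s| <= `|1 : R| -> ball x d (x + s *: (y - x)).
  move=> /ball_s sd; rewrite -ball_normE/= opprD addrA subrr sub0r.
  by rewrite normrN.
have [s s1|s /inball/dM[Us sM]] := @line_MVT _ _ (radial_integral p f) x (y - x) 1.
  have [Us _] := dM _ (inball s s1).
  by have [] := is_derive_radial_integral_dir p (y - x) Cf Us.
have [_ ->] := is_derive_radial_integral_dir p (y - x) Cf Us.
rewrite scale1r [x + (y - x)]addrC subrK mul1r distrC => ->.
apply: le_trans yeps; apply: le_trans (ler_norm_sum _ _ _) _.
apply: (@le_trans _ _ (\sum_i `|y - x| * M i)).
  apply: ler_sum => i _; rewrite normrM ler_pM//.
    rewrite [leRHS]mx_normrE.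
    by apply: (le_bigmax _ (fun ij => `|(y - x) ij.1 ij.2|) (ord0, i)).
  apply: le_radial_integral (Ck_partial i Cf) Us _ => t t01.
  by have [] := sM i t t01.
by rewrite -mulr_sumr ler_wpM2l// lerDl.
Unshelve. all: by end_near. Qed.

(** The induction passes from [p] and [f] to [p.+1] and [partial i f]. Continuity at each stage
    already uses one more derivative of [f], hence the hypothesis [smooth]. *)
Lemma Ck_radial_integral m p f : smooth U f -> Ck m U (radial_integral p f).
Proof.
elim: m p f => [|m IHm] p f sf.
  by split=> // x Ux; exact: radial_integral_continuous.
split=> [x Ux|i]; first exact: radial_integral_continuous.
have dPhi x : U x -> is_derive x (e i) (radial_integral p f)
    (radial_integral p.+1 (partial i f) x).
  by move=> Ux; exact: is_derive_radial_integral.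
split=> [x /dPhi[]//|].
apply: (eq_Ck Uopen) (IHm p.+1 (partial i f) _) => [x /dPhi[_ <-]//|m'].
by have [_ /(_ i)[]] := sf m'.+1.
Qed.

(* Integrates d/dt (t ^ k * f (x0 + t (x - x0))) over [0, 1]. *)
Lemma euler_radial_integral k f x : (0 < k)%N -> Ck 1 U f -> U x ->
  k%:R * radial_integral k.-1 f x +
    \sum_i (x - x0) ord0 i * radial_integral k (partial i f) x = f x.
Proof.
move=> k0 Cf Ux; pose v : 'rV[R]_n := x - x0.
have Cv : Ck 0 U (dir v f).
  by apply: Ck_sum => // i _; apply: CkZ => //; exact: Ck_partial Cf.
rewrite -(@radial_integral_sum 0 k _ _ (v ord0))//; last first.
  by move=> i; exact: Ck_partial Cf.
rewrite -/(dir v f) -RintegralZl//; last exact: integrable_integrand Cf Ux.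
rewrite -RintegralD//; last 2 first.
- have := integrable_integrand k.-1 (CkZ Uopen k%:R Cf) Ux.
  by apply: eq_integrable => // t _ /=; rewrite mulrA.
- exact: integrable_integrand Cv Ux.
pose F (t : R) := f (x0 + t *: v) * t ^+ k.
pose h (t : R) := k%:R * (f (x0 + t *: v) * t ^+ k.-1) +
  dir v f (x0 + t *: v) * t ^+ k.
have dF (t : R) : 0 <= t <= 1 -> is_derive t 1 F (h t).
  move=> t01; have Ut := star_segment Ux t01.
  have df : is_derive t 1 (fun t : R => f (x0 + t *: v)) (dir v f (x0 + t *: v)).
    apply/(is_derive_line f x0 v).
    by have := is_derive_sum_partial Uopen v Cf Ut.
  have dX : is_derive t 1 (fun t : R => t ^+ k) (k%:R * t ^+ k.-1).
    have := is_deriveX k (is_derive_id t 1).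
    rewrite /GRing.scale/= mulr1; congr (is_derive _ _ _ _).
    by apply/funext => y; rewrite exprfctE.
  have := is_deriveM df dX; rewrite /GRing.scale/=.
  suff -> : f (x0 + t *: v) * (k%:R * t ^+ k.-1) +
    t ^+ k * dir v f (x0 + t *: v) = h t by [].
  by rewrite /h; ring.
have cF (t : R) : 0 <= t <= 1 -> {for t, continuous F}.
  by move=> /dF[dFt _]; exact/differentiable_continuous/derivable1_diffP.
have ch : {within `[0, 1]%classic, continuous h}.
  apply: continuous_in_subspaceT => t; rewrite inE/= in_itv/= => t01.
  have c1 := continuous_at_integrand (p := k.-1) Cf Ux t01.
  have c2 := continuous_at_integrand (p := k) Cv Ux t01.
  apply: cvgD; last exact: c2.
  by apply: cvgM; [exact: cvg_cst|exact: c1].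
have F0 : derivable_oo_LRcontinuous F 0 1.
  split.
  - by move=> t t01; have [] := dF t (subset_itv_oo_cc t01).
  - by apply/cvg_at_right_filter/cF; rewrite lexx ler01.
  - by apply/cvg_at_left_filter/cF; rewrite lexx ler01.
have F'h : {in `]0, 1[, derive1 F =1 h}.
  by move=> t t01; rewrite derive1E; have [] := dF t (subset_itv_oo_cc t01).
rewrite /Rintegral (continuous_FTC2 ltr01 ch F0 F'h) /F scale0r addr0 scale1r.
(* The boundary term at [t = 0] vanishes because [k] is positive. *)
by rewrite /v [x0 + _]addrC subrK -EFinB/= expr1n mulr1 expr0n gtn_eqF// mulr0 subr0.
Qed.

End radial_integral.

(** * The Poincare lemma *)

Section signs.
Context {R : realType} {n : nat}.
Implicit Types (i j : 'I_n) (J K : {set 'I_n}).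
Local Notation sg i J := (shuffle_sign [set i]%SET J : R).

(** Moving [i] into place crosses the elements of [J] below it. In product form, adding an element
    to [J] contributes one factor. *)
Lemma shuffle_sign1E i J : sg i J = \prod_(j in J) (-1) ^+ (j < i)%N.
Proof.
rewrite prodrXr /shuffle_sign; congr (_ ^+ _).
rewrite -sum1_card big_mkcond/=.
rewrite (eq_bigr (fun p : 'I_n * 'I_n =>
  (if p.1 == i then (if p.2 \in J then (p.2 < i)%N : nat else 0%N) else 0%N))); last first.
  move=> [a b] _; rewrite !inE/=.
  by case: eqVneq => //= ->; case: (b \in J) => //=; case: (b < i)%N.
rewrite -(pair_bigA _ (fun a b : 'I_n =>
  (if a == i then (if b \in J then (b < i)%N : nat else 0%N) else 0%N)))/=.
rewrite (bigD1 i)//= [X in (_ + X)%N]big1 ?addn0; last first.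
  by move=> a /negPf ->; rewrite big1.
by rewrite eqxx -big_mkcond.
Qed.

Lemma shuffle_signU1 i j J : j \notin J ->
  sg i (j |: J)%SET = (-1) ^+ (j < i)%N * sg i J.
Proof. by move=> jJ; rewrite !shuffle_sign1E big_setU1. Qed.

(** The anticommutation of dx^i and dx^j at the level of signs: exactly one of [j < i] and [i < j]
    contributes a factor -1. *)
Lemma shuffle_sign_swap i j J : i != j -> i \notin J -> j \notin J ->
  sg i (j |: J)%SET * sg j J = - (sg j (i |: J)%SET * sg i J).
Proof.
move=> ij iJ jJ; rewrite !shuffle_signU1// -!mulrA [sg j J * _]mulrC.
by case: ltngtP ij => [_|_|/val_inj ->]; rewrite ?eqxx//= expr0 expr1 !mul1r
  mulN1r ?opprK.
Qed.

End signs.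

Section smooth_forms.
Context {R : realType} {n : nat}.
Variable U : set 'rV[R]_n.
Hypothesis Uopen : open U.
Implicit Types (i j : 'I_n) (I J K : {set 'I_n}) (w : 'rV[R]_n -> ext R n) (x v : 'rV[R]_n).
Local Notation sg i J := (shuffle_sign [set i]%SET J : R).
Local Notation e i := (delta_mx ord0 i : 'rV[R]_n).

Definition smooth_form w := forall I, smooth U (fun x => w x I).

Lemma smooth_partial f i : smooth U f -> smooth U (partial i f).
Proof. by move=> sf m; have [_ /(_ i)[]] := sf m.+1. Qed.

Lemma partialE f x i (a : R) : is_derive x (e i) f a -> partial i f x = a.
Proof. by case. Qed.

Lemma is_derive_bigsum (T : Type) (r : seq T) (P : pred T)
    (F : T -> 'rV[R]_n -> R) (dF : T -> R) x v :
  (forall a, P a -> is_derive x v (F a) (dF a)) ->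
  is_derive x v (fun y => \sum_(a <- r | P a) F a y) (\sum_(a <- r | P a) dF a).
Proof.
move=> FdF; elim: r => [|a r IHr].
  have -> : (fun y => \sum_(a <- [::] | P a) F a y) = cst 0.
    by apply/funext => y; rewrite big_nil.
  by rewrite big_nil; exact: is_derive_cst.
have -> : (fun y => \sum_(b <- a :: r | P b) F b y) =
    (if P a then F a else cst 0) + (fun y => \sum_(b <- r | P b) F b y).
  apply/funext => y; rewrite big_cons fctE.
  by case: (P a); rewrite //= add0r.
rewrite big_cons; case Pa : (P a); first exact: is_deriveD (FdF a Pa) IHr.
by rewrite -[X in is_derive _ _ _ X]add0r; exact: is_deriveD.
Qed.

Lemma wedge_dx1 i (b : ext R n) K :
  wedge (dx [set i]%SET) b K = if i \in K then sg i (K :\ i)%SET * b (K :\ i)%SET else 0.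
Proof.
rewrite ffunE; case: ifPn => iK.
  rewrite (bigD1 [set i]%SET) ?finset.sub1set//= ffunE eqxx mulr1.
  rewrite big1 ?addr0// => I /andP[_ /negPf Ii].
  by rewrite ffunE Ii mulr0 mul0r.
rewrite big1// => I IK; rewrite ffunE; case: eqVneq => [E|]; last by rewrite mulr0 mul0r.
by move: iK; rewrite -finset.sub1set -E IK.
Qed.

Lemma ext_dE w x K : ext_d w x K =
  \sum_(i in K) sg i (K :\ i)%SET * partial i (fun y => w y (K :\ i)%SET) x.
Proof.
rewrite /ext_d sum_ffunE [RHS]big_mkcond; apply: eq_bigr => i _.
by rewrite wedge_dx1 ffunE.
Qed.

Lemma ext_d_eq w w' x : (forall y, U y -> w y = w' y) -> U x ->
  ext_d w x = ext_d w' x.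
Proof.
move=> ww' Ux; apply/ffunP => K; rewrite !ext_dE; apply: eq_bigr => i _.
by congr (_ * _); apply: (eq_partial Uopen) => // y Uy; rewrite ww'.
Qed.

Lemma smooth_ext_d w : smooth_form w -> smooth_form (ext_d w).
Proof.
move=> sw K m.
have C : Ck m U (fun x =>
    \sum_(i in K) sg i (K :\ i)%SET * partial i (fun y => w y (K :\ i)%SET) x).
  by apply: Ck_sum => // i _; apply: CkZ => //; exact: smooth_partial.
by apply: (eq_Ck Uopen) C => x _; rewrite ext_dE.
Qed.

Lemma ext_d_homogeneous k w x :
  (forall y, homogeneous k (w y)) -> homogeneous k.+1 (ext_d w x).
Proof.
move=> hw K Kk; rewrite ext_dE big1// => i iK.
rewrite (_ : (fun y => w y (K :\ i)%SET) = cst 0); last first.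
  apply/funext => y; apply: hw; apply: contra Kk => /eqP <-.
  by rewrite (cardsD1 i K) iK.
by rewrite /partial derive_cst mulr0.
Qed.

Lemma ext_d_linear (a : R) w w' x : smooth_form w -> smooth_form w' -> U x ->
  ext_d (a *: w + w') x = a *: ext_d w x + ext_d w' x.
Proof.
move=> sw sw' Ux; apply/ffunP => K.
rewrite !ffunE !ext_dE scaler_sumr -big_split/=; apply: eq_bigr => i _.
rewrite /GRing.scale/= mulrCA -mulrDr; congr (_ * _).
have d1 := Ck_is_derive i (sw (K :\ i)%SET 1%N) Ux.
have d2 := Ck_is_derive i (sw' (K :\ i)%SET 1%N) Ux.
have -> : (fun y => (a *: w + w') y (K :\ i)%SET) =
    a *: (fun y => w y (K :\ i)%SET) + (fun y => w' y (K :\ i)%SET).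
  by apply/funext => y; rewrite !ffunE.
by have /partialE := is_deriveD (is_deriveZ a d1) d2.
Qed.

Lemma ext_d_ext_d w x : smooth_form w -> U x -> ext_d (ext_d w) x = 0.
Proof.
move=> sw Ux; apply/ffunP => K; rewrite ext_dE [RHS]ffunE.
pose T j i := sg j (K :\ j)%SET * (sg i (K :\ j :\ i)%SET *
  partial j (partial i (fun y => w y (K :\ j :\ i)%SET)) x).
have -> : \sum_(j in K) sg j (K :\ j)%SET *
     partial j (fun y => ext_d w y (K :\ j)%SET) x =
   \sum_(j in K) \sum_(i in K :\ j) T j i.
  apply: eq_bigr => j _; rewrite -mulr_sumr; congr (_ * _).
  have -> : (fun y => ext_d w y (K :\ j)%SET) = (fun y => \sum_(i in K :\ j)
     sg i (K :\ j :\ i)%SET * partial i (fun z => w z (K :\ j :\ i)%SET) y).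
    by apply/funext => y; rewrite ext_dE.
  suff : is_derive x (e j) (fun y => \sum_(i in K :\ j)
      sg i (K :\ j :\ i)%SET * partial i (fun z => w z (K :\ j :\ i)%SET) y)
    (\sum_(i in K :\ j) sg i (K :\ j :\ i)%SET *
       partial j (partial i (fun y => w y (K :\ j :\ i)%SET)) x) by move/partialE.
  apply: is_derive_bigsum => i _.
  have := Ck_is_derive j (smooth_partial i (sw (K :\ j :\ i)%SET) 1%N) Ux.
  exact: is_deriveZ.
(* The derivatives are symmetric in [i] and [j], the products of the two signs antisymmetric.
   Exchanging the two sums then shows that the total is its own negative. *)
have TN i j : i \in K -> j \in K -> i != j -> T j i = - T i j.
  move=> iK jK ij; rewrite /T finset.setDDl finset.setUC -finset.setDDl.
  set J := (K :\ i :\ j)%SET.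
  rewrite (schwarz Uopen j i (sw J 2%N) Ux) !mulrA -mulNr; congr (_ * _).
  have -> : (K :\ j)%SET = (i |: J)%SET.
    apply/finset.setP => l; rewrite !inE.
    by have [->|_] := eqVneq l i; rewrite ?ij ?iK.
  have -> : (K :\ i)%SET = (j |: J)%SET.
    by rewrite /J finset.setD1K// !inE eq_sym ij.
  by rewrite shuffle_sign_swap// ?inE ?eqxx// ?andbF// eq_sym.
set S := \sum_(j in K) _.
suff SN : S = - S by move: SN; move: (S) => s ?; lra.
rewrite {1}/S (exchange_big_dep (mem K))/=; last first.
  by move=> j i _; rewrite !inE => /andP[].
rewrite -sumrN; apply: eq_bigr => i iK; rewrite -sumrN; apply: eq_big => j.
  by rewrite !inE iK andbT andbC eq_sym.
by rewrite !inE => /andP[jK /andP[ij _]]; rewrite TN// opprK.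
Qed.

End smooth_forms.

Section poincare.
Context {R : realType} {n : nat}.
Variables (U : set 'rV[R]_n) (x0 : 'rV[R]_n).
Hypothesis Uopen : open U.
Hypothesis Ustar : forall x, U x -> exists K : set 'rV[R]_n,
  [/\ compact K, K `<=` U, nbhs x K &
      forall y (t : R), K y -> 0 <= t <= 1 -> K (x0 + t *: (y - x0))].
Implicit Types (i j : 'I_n) (I J K : {set 'I_n}) (w : 'rV[R]_n -> ext R n) (x v : 'rV[R]_n).
Local Notation sg i J := (shuffle_sign [set i]%SET J : R).
Local Notation e i := (delta_mx ord0 i : 'rV[R]_n).
Local Notation Phi := (radial_integral x0).

(** The vector [x - x0] is taken at [x] and not along the segment, so it leaves the integral. *)
Lemma homotopyE w x J : smooth_form U w -> U x -> homotopy x0 w x J =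
  \sum_(i | i \notin J) sg i J * (x - x0) ord0 i *
     Phi #|J| (fun y => w y (i |: J)%SET) x.
Proof.
move=> sw Ux; rewrite ffunE -big_filter.
rewrite -(@radial_integral_sum _ _ _ _ Uopen Ustar 0 #|J| _ _
  (fun i => sg i J * (x - x0) ord0 i))//; last by move=> i; exact: sw.
by apply: eq_Rintegral => t _; rewrite ffunE big_filter.
Qed.

Lemma homotopy_eq w w' x : (forall y, U y -> w y = w' y) -> U x ->
  homotopy x0 w x = homotopy x0 w' x.
Proof.
move=> ww' Ux; apply/ffunP => J; rewrite !ffunE.
apply: eq_Rintegral => t; rewrite inE/= in_itv/= => t01.
by rewrite ww'//; exact: star_segment Ustar _ _ Ux t01.
Qed.

Lemma homotopy_homogeneous k w x :
  (forall y, homogeneous k.+1 (w y)) -> homogeneous k (homotopy x0 w x).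
Proof.
move=> hw J Jk; rewrite ffunE.
rewrite (@eq_Rintegral _ _ _ _ _ (cst 0)).
  by rewrite Rintegral_cst// mul0r.
move=> t _; rewrite ffunE big1 ?mul0r// => i iJ.
by rewrite hw ?mulr0// cardsU1 iJ.
Qed.

Lemma smooth_homotopy w : smooth_form U w -> smooth_form U (homotopy x0 w).
Proof.
move=> sw J m.
have C : Ck m U (fun x => \sum_(i | i \notin J) sg i J * (x - x0) ord0 i *
     Phi #|J| (fun y => w y (i |: J)%SET) x).
  apply: Ck_sum => // i _; apply: CkM => //; last first.
    exact: Ck_radial_integral.
  apply: CkZ => //; apply: (eq_Ck Uopen) (CkD Uopen (Ck_coord Uopen m i)
    (Ck_cst Uopen m (- x0 ord0 i))) => x _.
  by rewrite !mxE.
by apply: (eq_Ck Uopen) C => x Ux; rewrite homotopyE.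
Qed.

Lemma smooth_form_linear (a : R) w w' :
  smooth_form U w -> smooth_form U w' -> smooth_form U (a *: w + w').
Proof.
move=> sw sw' I m.
apply: (eq_Ck Uopen) (CkD Uopen (CkZ Uopen a (sw I m)) (sw' I m)) => x _.
by rewrite !ffunE.
Qed.

Lemma homotopy_linear (a : R) w w' x : smooth_form U w -> smooth_form U w' ->
  U x -> homotopy x0 (a *: w + w') x = a *: homotopy x0 w x + homotopy x0 w' x.
Proof.
move=> sw sw' Ux; apply/ffunP => J; rewrite [RHS]ffunE [X in _ = X + _]ffunE.
rewrite !homotopyE//; last exact: smooth_form_linear.
rewrite scaler_sumr -big_split/=; apply: eq_bigr => i _.
rewrite /GRing.scale/= mulrCA -mulrDr; congr (_ * _).
(* A combination of two terms, seen as a sum over the two booleans. *)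
have := @radial_integral_sum _ _ _ _ Uopen Ustar 0 #|J| _ [:: true; false]
  (fun b : bool => if b then a else 1)
  (fun (b : bool) y => if b then w y (i |: J)%SET else w' y (i |: J)%SET) x.
rewrite !big_cons !big_nil !addr0 mul1r => <-//.
  apply: eq_Rintegral => t _.
  by rewrite !big_cons big_nil addr0 mul1r !ffunE.
by case; [exact: sw|exact: sw'].
Qed.

Lemma partial_homotopy w x j J : smooth_form U w -> U x ->
  partial j (fun y => homotopy x0 w y J) x =
  \sum_(i | i \notin J) sg i J *
    ((i == j)%:R * Phi #|J| (fun y => w y (i |: J)%SET) x +
     (x - x0) ord0 i * Phi #|J|.+1 (partial j (fun y => w y (i |: J)%SET)) x).
Proof.
move=> sw Ux.
rewrite (eq_partial Uopen _ (fun y Uy => homotopyE J sw Uy) Ux).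
suff : is_derive x (e j) (fun y => \sum_(i | i \notin J)
    sg i J * (y - x0) ord0 i * Phi #|J| (fun y => w y (i |: J)%SET) y)
  (\sum_(i | i \notin J) sg i J *
    ((i == j)%:R * Phi #|J| (fun y => w y (i |: J)%SET) x +
     (x - x0) ord0 i * Phi #|J|.+1 (partial j (fun y => w y (i |: J)%SET)) x))
  by move/partialE.
apply: is_derive_bigsum => i _.
have dc : is_derive x (e j) (fun y : 'rV[R]_n => (y - x0) ord0 i) (i == j)%:R.
  have := is_deriveD (is_derive_coord x (e j) i) (is_derive_cst (- x0 ord0 i) x (e j)).
  rewrite addr0 !mxE eqxx/=.
  by congr (is_derive _ _ _ _); apply/funext => y; rewrite fctE !mxE.
have dPhi := is_derive_radial_integral Uopen Ustar #|J| j (sw (i |: J)%SET 1%N) Ux.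
have := is_deriveZ (sg i J) (is_deriveM dc dPhi).
rewrite /GRing.scale/= addrC [X in X + _]mulrC.
by congr (is_derive _ _ _ _); apply/funext => y; exact: mulrA.
Qed.

(** The [K]-th coefficient of d H w is a sum over [j] in [K] and [i] outside [K :\ j]. The terms
    with [i = j] give [#|K|] times a radial integral and the radial derivative along the directions
    in [K]; closedness turns the others into the radial derivative along the directions outside [K]
    ([cross]). The total is Euler's identity. At the empty set d H w has coefficient 0, so that of
    [w] must vanish. *)
Lemma ext_d_homotopy w x : smooth_form U w ->
  (forall y, U y -> ext_d w y = 0) -> (forall y, U y -> w y finset.set0 = 0) ->
  U x -> ext_d (homotopy x0 w) x = w x.
Proof.
move=> sw dw0 w0 Ux; apply/ffunP => K; rewrite ext_dE.
have [->|Kn0] := eqVneq K finset.set0; first by rewrite big_set0 w0.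
have K0 : (0 < #|K|)%N by rewrite card_gt0.
pose v i := (x - x0) ord0 i.
pose wK y := w y K.
have -> : \sum_(i in K) sg i (K :\ i)%SET *
    partial i (fun y => homotopy x0 w y (K :\ i)%SET) x =
  \sum_(j in K) (Phi #|K|.-1 wK x + v j * Phi #|K| (partial j wK) x +
    \sum_(i | i \notin K) sg j (K :\ j)%SET * sg i (K :\ j)%SET * (v i *
       Phi #|K| (partial j (fun y => w y (i |: K :\ j)%SET)) x)).
  apply: eq_bigr => j jK; rewrite partial_homotopy//.
  have cK : #|(K :\ j)%SET| = #|K|.-1 by rewrite (cardsD1 j K) jK.
  rewrite cK prednK// (bigD1 j)/= ?inE ?eqxx//= mulrDr.
  rewrite mulrA shuffle_sign_sqr !mul1r finset.setD1K//; congr (_ + _).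
  rewrite mulr_sumr; apply: eq_big => i.
    by rewrite !inE negb_and negbK; case: eqVneq => [->|]; rewrite ?jK ?andbT.
  by move=> /andP[_ /negPf ij]; rewrite ij mul0r add0r mulrA.
have split_sums (A : R) (B : 'I_n -> R) (C : 'I_n -> 'I_n -> R) :
    \sum_(j in K) (A + B j + \sum_(i | i \notin K) C j i) =
    #|K|%:R * A + \sum_(j in K) B j + \sum_(i | i \notin K) \sum_(j in K) C j i.
  rewrite big_split/= big_split/=; congr (_ + _ + _); last exact: exchange_big.
  by rewrite sumr_const mulr_natl.
rewrite split_sums.
have cross i : i \notin K ->
    \sum_(j in K) sg j (K :\ j)%SET * sg i (K :\ j)%SET * (v i *
       Phi #|K| (partial j (fun y => w y (i |: K :\ j)%SET)) x) =
    v i * Phi #|K| (partial i wK) x.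
  move=> iK; under eq_bigr => j _ do rewrite mulrCA.
  rewrite -mulr_sumr; congr (_ * _); rewrite -big_filter.
  rewrite -(@radial_integral_sum _ _ _ _ Uopen Ustar 0 #|K| _ _
    (fun j => sg j (K :\ j)%SET * sg i (K :\ j)%SET)
    (fun j => partial j (fun y => w y (i |: K :\ j)%SET)))//; last first.
    by move=> j; exact: (smooth_partial j (sw (i |: K :\ j)%SET) 0%N).
  apply: (radial_integral_eq Ustar) => // y Uy.
  (* The equation d w = 0 at the index set [i |: K], solved for [partial i wK]: multiplying by
     [sg i K], whose square is 1, isolates it. *)
  have /ffunP/(_ (i |: K)%SET) := dw0 y Uy; rewrite ext_dE ffunE big_setU1//=.
  rewrite finset.setU1K// => /eqP; rewrite addr_eq0 => /eqP.
  move=> /(congr1 (fun z => sg i K * z)); rewrite mulrA shuffle_sign_sqr mul1r.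
  move=> ->; rewrite big_filter mulrN mulr_sumr -sumrN.
  apply: eq_bigr => j jK.
  have ij : i != j by apply: contraNneq iK => ->.
  have -> : ((i |: K) :\ j)%SET = (i |: K :\ j)%SET.
    apply/finset.setP => l; rewrite !inE; case: (eqVneq l i) => [->|]//=.
    by rewrite ij.
  rewrite mulrA -mulNr; congr (_ * _).
  have jn : j \notin (K :\ j)%SET by rewrite !inE eqxx.
  have in_ : i \notin (K :\ j)%SET by rewrite !inE negb_and iK orbT.
  rewrite -[in X in - (X * _)](finset.setD1K jK) !shuffle_signU1//.
  rewrite mulrACA [sg i _ * sg j _]mulrC.
  by case: ltngtP ij => [_|_|/val_inj ->]; rewrite ?eqxx//= ?expr0 ?expr1 ?mul1r ?mulr1
    mulN1r ?opprK.
apply: etrans (euler_radial_integral Uopen Ustar K0 (sw K 1%N) Ux).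
rewrite -addrA; congr (_ + _); rewrite [RHS](bigID (mem K))/=; congr (_ + _).
exact: eq_bigr.
Qed.

End poincare.

(** * The decomposition *)

Section hodge_forms.
Context {R : realType} {n : nat}.
Implicit Types (a b : ext R n) (G : 'M[R]_n) (I J K : {set 'I_n}).

Lemma ext_linE (c : R) a b I : (c *: a + b) I = c * a I + b I.
Proof. by rewrite !ffunE. Qed.

Lemma gram_eq0 G I J : #|I| != #|J| -> gram G I J = 0.
Proof. exact: minor_eq0. Qed.

Lemma hodge_homogeneous G o k b : (k <= n)%N ->
  homogeneous k b -> homogeneous (n - k) (hodge G o b).
Proof.
move=> kn hb J Jk; rewrite ffunE big1 ?mulr0// => K _.
have [Kk|/hb ->] := eqVneq #|K| k; last by rewrite mulr0.
rewrite gram_eq0 ?mul0r// Kk; apply: contra Jk => /eqP <-.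
by have /eqP := cardsC J; rewrite card_ord => /eqP E; rewrite -{1}(addnK #|~: J| #|J|) E.
Qed.

Lemma hodge_inverse_homogeneous G o k b : (k <= n)%N ->
  homogeneous (n - k) b -> homogeneous k (hodge_inverse G o b).
Proof.
move=> kn hb K Kk; rewrite ffunE big1// => I _.
have [KI|KI] := eqVneq #|K| #|I|; last by rewrite minor_eq0// mul0r.
rewrite hb ?mulr0//; apply: contra Kk => /eqP E.
have := cardsC I; rewrite card_ord KI E => H.
by rewrite -(eqn_add2r (n - k)%N) H subnKC.
Qed.

Lemma hodge_linear G o (c : R) a b :
  hodge G o (c *: a + b) = c *: hodge G o a + hodge G o b.
Proof.
apply/ffunP => J; rewrite ext_linE ![hodge _ _ _ _]ffunE.
have -> : \sum_K gram G (~: J) K * (c *: a + b) K =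
    c * (\sum_K gram G (~: J) K * a K) + \sum_K gram G (~: J) K * b K.
  rewrite mulr_sumr -big_split/=; apply: eq_bigr => K _.
  by rewrite ext_linE mulrDr mulrCA.
by ring.
Qed.

Lemma hodge_inverse_linear G o (c : R) a b :
  hodge_inverse G o (c *: a + b) = c *: hodge_inverse G o a + hodge_inverse G o b.
Proof.
apply/ffunP => J; rewrite ext_linE ![hodge_inverse _ _ _ _]ffunE.
rewrite mulr_sumr -big_split/=; apply: eq_bigr => K _.
by rewrite ext_linE; ring.
Qed.

Lemma grade_involutionK : involutive (@grade_involution R n).
Proof.
by move=> a; apply/ffunP => I; rewrite !ffunE mulrA -expr2 sqrr_sign mul1r.
Qed.

Lemma grade_involution_linear (c : R) a b :
  grade_involution (c *: a + b) = c *: grade_involution a + grade_involution b.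
Proof.
apply/ffunP => I; rewrite ext_linE ![grade_involution _ _]ffunE ext_linE.
by rewrite mulrDr mulrCA.
Qed.

Lemma grade_involution_homogeneous k a :
  homogeneous k a -> homogeneous k (grade_involution a).
Proof. by move=> ha I /ha aI; rewrite ffunE aI mulr0. Qed.

End hodge_forms.

Section hodge_decomposition.
Context {R : realType} {n : nat}.
Hypothesis n_gt0 : (0 < n)%N.
Variables (U : set 'rV[R]_n) (x0 : 'rV[R]_n).
Hypothesis Uopen : open U.
Hypothesis Ustar : forall x, U x -> exists K : set 'rV[R]_n,
  [/\ compact K, K `<=` U, nbhs x K &
      forall y (t : R), K y -> 0 <= t <= 1 -> K (x0 + t *: (y - x0))].
Variables (g : 'rV[R]_n -> 'M[R]_n) (o : bool).
Hypothesis gP : riemannian_metric U g.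
Implicit Types (w : 'rV[R]_n -> ext R n) (x : 'rV[R]_n).

Lemma metric_det_gt0 x : U x -> 0 < \det (g x).
Proof. by move=> Ux; apply: posdef_det_gt0; case: gP => _ _; exact. Qed.

Lemma metric_smooth i j : smooth U (fun x => g x i j).
Proof. by case: gP => + _ _; exact. Qed.

Lemma metric_unit x : U x -> g x \in unitmx.
Proof. by move=> /metric_det_gt0 dg; rewrite unitmxE unitfE gt_eqF. Qed.

Lemma star_invE w x : U x -> star_inv g o w x = hodge_inverse (g x) o (w x).
Proof. by move=> Ux; rewrite /star_inv hodge_invE//; exact: metric_det_gt0. Qed.

Lemma star_invK w x : U x -> star g o (star_inv g o w) x = w x.
Proof.
by move=> Ux; rewrite /star star_invE// hodge_inverseK//; exact: metric_det_gt0.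
Qed.

Lemma smooth_minor (A : 'rV[R]_n -> 'M[R]_n) I J :
  (forall i j, smooth U (fun x => A x i j)) ->
  smooth U (fun x => minor (A x) I J).
Proof.
move=> sA m; rewrite /minor; case: eqVneq => _; last exact: Ck_cst.
apply: Ck_det => // p q.
have C := sA (enum_val p) (nth (enum_val p) (enum J) q) m.
by apply: (eq_Ck Uopen) C => x _; rewrite mxE.
Qed.

Lemma smooth_scale_volume m :
  Ck m U (fun x => (-1) ^+ o * Num.sqrt (\det (g x))).
Proof.
apply: CkZ => //; apply: Ck_sqrt => //; first exact: metric_det_gt0.
by apply: Ck_det => // i j; exact: metric_smooth.
Qed.

Lemma smooth_star w : smooth_form U w -> smooth_form U (star g o w).
Proof.
move=> sw J m.
have C : Ck m U (fun x => shuffle_sign (~: J) J *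
    ((-1) ^+ o * Num.sqrt (\det (g x))) *
    \sum_K gram (g x) (~: J) K * w x K).
  apply: CkM => //; first by apply: CkZ => //; exact: smooth_scale_volume.
  apply: Ck_sum => // K _; apply: CkM => //; last exact: sw.
  apply: (@smooth_minor (fun x => invmx (g x))) => i j m'.
  by apply: Ck_invmx => //; [exact: metric_unit|move=> a b; exact: metric_smooth].
by apply: (eq_Ck Uopen) C => x _; rewrite ffunE.
Qed.

Lemma smooth_star_inv w : smooth_form U w -> smooth_form U (star_inv g o w).
Proof.
move=> sw K m.
have C : Ck m U (fun x => \sum_I minor (g x) K I *
     (shuffle_sign I (~: I) * ((-1) ^+ o * Num.sqrt (\det (g x)))^-1 *
      w x (~: I)%SET)).
  apply: Ck_sum => // I _; apply: CkM => //.
    by apply: smooth_minor; exact: metric_smooth.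
  apply: CkM => //; last exact: sw.
  apply: CkZ => //; apply: CkV => //; last exact: smooth_scale_volume.
  move=> x Ux; rewrite mulf_neq0 ?signr_eq0// sqrtr_eq0 -ltNge.
  exact: metric_det_gt0.
by apply: (eq_Ck Uopen) C => x Ux; rewrite star_invE// ffunE.
Qed.

Lemma smooth_eta w : smooth_form U w -> smooth_form U (eta w).
Proof.
move=> sw K m; apply: (eq_Ck Uopen) (CkZ Uopen ((-1) ^+ #|K|) (sw K m)) => x _.
by rewrite /eta ffunE.
Qed.

Lemma smooth_codiff w : smooth_form U w -> smooth_form U (codiff g o w).
Proof.
by move=> sw; apply/smooth_star_inv/smooth_ext_d => //; exact/smooth_star/smooth_eta.
Qed.

Lemma smooth_cohomotopy w :
  smooth_form U w -> smooth_form U (cohomotopy g o x0 w).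
Proof.
move=> sw; apply/smooth_eta/smooth_star_inv/smooth_homotopy => //.
exact: smooth_star.
Qed.

(** Equalities known only on [U] may be used under [codiff] because [U] is open, and under
    [cohomotopy], next, because [U] contains the segments to [x0]. *)
Lemma codiff_eq w w' x : (forall y, U y -> w y = w' y) -> U x ->
  codiff g o w x = codiff g o w' x.
Proof.
move=> ww' Ux; rewrite /codiff (star_invE _ Ux) (star_invE _ Ux); congr hodge_inverse.
by apply: (ext_d_eq Uopen) => // y Uy; rewrite /star /eta ww'.
Qed.

Lemma cohomotopy_eq w w' x : (forall y, U y -> w y = w' y) -> U x ->
  cohomotopy g o x0 w x = cohomotopy g o x0 w' x.
Proof.
move=> ww' Ux; rewrite /cohomotopy /eta (star_invE _ Ux) (star_invE _ Ux).
congr (grade_involution (hodge_inverse _ _ _)).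
by apply: (homotopy_eq Ustar) => // y Uy; rewrite /star ww'.
Qed.

Lemma codiff_linear (a : R) w w' x : smooth_form U w -> smooth_form U w' ->
  U x -> codiff g o (a *: w + w') x = a *: codiff g o w x + codiff g o w' x.
Proof.
move=> sw sw' Ux; rewrite /codiff (star_invE _ Ux) (star_invE _ Ux) (star_invE _ Ux) -hodge_inverse_linear.
congr hodge_inverse; rewrite -(ext_d_linear _ _ _ Ux)//; last 2 first.
- exact/smooth_star/smooth_eta.
- exact/smooth_star/smooth_eta.
apply: (ext_d_eq Uopen) => // y _.
by rewrite /star /eta grade_involution_linear hodge_linear.
Qed.

Lemma cohomotopy_linear (a : R) w w' x : smooth_form U w -> smooth_form U w' ->
  U x -> cohomotopy g o x0 (a *: w + w') x =
    a *: cohomotopy g o x0 w x + cohomotopy g o x0 w' x.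
Proof.
move=> sw sw' Ux; rewrite /cohomotopy /eta (star_invE _ Ux) (star_invE _ Ux) (star_invE _ Ux).
rewrite -grade_involution_linear -hodge_inverse_linear.
congr (grade_involution (hodge_inverse _ _ _)).
rewrite -(homotopy_linear Uopen Ustar)//; last 2 first.
- exact: smooth_star.
- exact: smooth_star.
by apply: (homotopy_eq Ustar) => // y _; rewrite /star hodge_linear.
Qed.

Lemma cohomotopy0 x : U x -> cohomotopy g o x0 0 x = 0.
Proof.
move=> Ux; have s0 : smooth_form U 0.
  by move=> I m; apply: (eq_Ck Uopen) (Ck_cst Uopen m 0) => y _; rewrite ffunE.
(* Linearity at zero forms with scalar -1 reads h 0 = - h 0 + h 0. *)
have := cohomotopy_linear (-1) s0 s0 Ux.
by rewrite scaler0 addr0 scaleN1r addNr.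
Qed.

Lemma star_eta_cohomotopy w x : U x ->
  star g o (eta (cohomotopy g o x0 w)) x = homotopy x0 (star g o w) x.
Proof.
move=> Ux; rewrite {1}/star {1}/eta /cohomotopy {1}/eta grade_involutionK.
exact: star_invK.
Qed.

Lemma codiff_cohomotopy_codiff w x : smooth_form U w -> U x ->
  codiff g o (cohomotopy g o x0 (codiff g o w)) x = codiff g o w x.
Proof.
move=> sw Ux; rewrite {1}/codiff [in RHS]/codiff (star_invE _ Ux) (star_invE _ Ux).
set s := star g o (eta w); congr hodge_inverse.
have ss : smooth_form U s by exact/smooth_star/smooth_eta.
have sds : smooth_form U (ext_d s) by exact: smooth_ext_d.
rewrite -(ext_d_homotopy Uopen Ustar sds _ _ Ux); last 2 first.
- by move=> y Uy; exact: (ext_d_ext_d Uopen).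
(* At the empty index set an exterior derivative is an empty sum. *)
- by move=> y Uy; rewrite ext_dE big_set0.
apply: (ext_d_eq Uopen) => // y Uy.
rewrite star_eta_cohomotopy//; apply: (homotopy_eq Ustar) => // z Uz.
exact: star_invK.
Qed.

(** The inner [star] and [star_inv] cancel on [U], and the degree runs through k, n - k, n - k + 1,
    n - k and back to k; [k <= n] makes the truncated subtraction exact. *)
Lemma cohomotopy_codiff_homogeneous k w x : (k <= n)%N ->
  (forall y, homogeneous k (w y)) -> U x ->
  homogeneous k (cohomotopy g o x0 (codiff g o w) x).
Proof.
move=> kn hw Ux; apply: grade_involution_homogeneous; rewrite star_invE//.
apply: hodge_inverse_homogeneous => //.
rewrite (@homotopy_eq _ _ _ _ Ustar _ (ext_d (star g o (eta w))))//; last first.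
  by move=> y Uy; exact: star_invK.
apply: homotopy_homogeneous => y; apply: ext_d_homogeneous => z.
by apply: hodge_homogeneous => //; exact: grade_involution_homogeneous.
Qed.

Lemma Lambda_linear k (a : R) w w' : Lambda k U w -> Lambda k U w' ->
  Lambda k U (a *: w + w').
Proof.
move=> [w0 hw sw] [w'0 hw' sw']; split.
- by move=> x Ux; rewrite !fctE w0// w'0// scaler0 addr0.
- by move=> x I Ik; rewrite !ffunE hw// hw'// scaler0 addr0.
- exact: smooth_form_linear.
Qed.

Lemma Lambda0 k : Lambda k U 0.
Proof.
split=> [//|x I _|I m]; first by rewrite ffunE.
by apply: (eq_Ck Uopen) (Ck_cst Uopen m 0) => y _; rewrite ffunE.
Qed.

Lemma codiff0 x : U x -> codiff g o 0 x = 0.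
Proof.
move=> Ux; have [_ _ s0] := Lambda0 0.
have := codiff_linear (-1) s0 s0 Ux.
by rewrite scaler0 addr0 scaleN1r addNr.
Qed.

Lemma submod_closed_set (V : lmodType R) (A : set V) : A 0 ->
  (forall (a : R) u v, A u -> A v -> A (a *: u + v)) -> submod_closed (mem A).
Proof.
by move=> A0 AD; split=> [|a u v]; rewrite !inE//; exact: AD.
Qed.

Lemma coexact_anticoexact_direct_sum k : (k <= n)%N ->
  direct_sum (Lambda k U) (coexact k U g o) (anticoexact k U g o x0).
Proof.
have h0 x : U x -> cohomotopy g o x0 (codiff g o 0) x = 0.
  by move=> Ux; rewrite (@cohomotopy_eq _ 0 _ codiff0 Ux) cohomotopy0.
move=> kn; split.
- apply: submod_closed_set => [|a u v [Lu du] [Lv dv]].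
    by split; [exact: Lambda0|exact: codiff0].
  split; first exact: Lambda_linear.
  move=> x Ux; have [[_ _ su] [_ _ sv]] := (Lu, Lv).
  by rewrite codiff_linear// du// dv// scaler0 addr0.
- apply: submod_closed_set => [|a u v [Lu du] [Lv dv]].
    by split; [exact: Lambda0|move=> x Ux; rewrite h0].
  split; first exact: Lambda_linear.
  move=> x Ux; have [[_ _ su] [_ _ sv]] := (Lu, Lv).
  have duv y : U y -> codiff g o (a *: u + v) y =
      (a *: codiff g o u + codiff g o v) y by move=> Uy; rewrite codiff_linear.
  rewrite (cohomotopy_eq duv Ux) cohomotopy_linear//; [|exact: smooth_codiff..].
  by rewrite -du// -dv.
- apply/seteqP; split=> [w [[[w0 _ _] dw] [_ hw]]|_ ->]; last first.
    split; split; [exact: Lambda0|exact: codiff0|exact: Lambda0|].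
    by move=> x Ux; rewrite h0.
  apply/funext => x; have [Ux|/w0//] := pselect (U x).
  (* On [U], w = h delta w = h 0 = 0. *)
  by rewrite hw// (@cohomotopy_eq _ 0 _ dw Ux) cohomotopy0.
- apply/seteqP; split=> [w Lw|_ [u [Lu _] [v [Lv _] <-]]]; last first.
    by have := Lambda_linear 1 Lu Lv; rewrite scale1r.
  have [w0 hw sw] := Lw.
  (* The cut-off makes [p] a representative in [Lambda k U], since the values of [cohomotopy]
     outside [U] are arbitrary. *)
  pose p x := if pselect (U x) then cohomotopy g o x0 (codiff g o w) x else 0.
  have pE x : U x -> cohomotopy g o x0 (codiff g o w) x = p x.
    by move=> Ux; rewrite /p; case: pselect.
  have p0 x : ~ U x -> p x = 0 by rewrite /p; case: pselect.
  have sp : smooth_form U p.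
    move=> I m; have C := smooth_cohomotopy (smooth_codiff sw) I m.
    by apply: (eq_Ck Uopen) C => x /pE ->.
  have Lp : Lambda k U p.
    split=> // x; have [Ux|/p0 ->] := pselect (U x).
      by rewrite -(pE x Ux); exact: cohomotopy_codiff_homogeneous.
    by move=> I _; rewrite ffunE.
  have dp x : U x -> codiff g o p x = codiff g o w x.
    by move=> Ux; rewrite -(codiff_eq pE Ux); exact: codiff_cohomotopy_codiff.
  exists (- 1 *: p + w); last exists p.
  + split; first exact: Lambda_linear.
    by move=> x Ux; rewrite codiff_linear// dp// scaleN1r addNr.
  + split; [exact: Lp|move=> x Ux; rewrite -(pE x Ux)].
    (* From delta p = delta w follows h delta p = h delta w = p on [U]. *)
    exact: cohomotopy_eq (fun y Uy => esym (dp y Uy)) Ux.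
  + by rewrite scaleN1r addrC addrA subrr add0r.
Qed.

End hodge_decomposition.

(** * Compact star-shaped neighbourhoods in a Euclidean ball *)

Section euclidean_ball.
Context {R : realType} {n : nat}.
Variables (c : 'rV[R]_n) (r : R).
Hypothesis r_gt0 : 0 < r.
Implicit Types (x y : 'rV[R]_n).

Let dist2 x := \sum_i (x ord0 i - c ord0 i) ^+ 2.

Lemma continuous_sqr_dist : continuous dist2.
Proof.
move=> x; have C : Ck 0 setT dist2.
  apply: Ck_sum => [|i _]; first exact: openT.
  have C1 : Ck 0 setT (fun x : 'rV[R]_n => x ord0 i - c ord0 i).
    apply: CkD; [exact: openT|apply: Ck_coord; exact: openT|].
    exact: Ck_cst openT _ _.
  by have := CkM openT C1 C1; apply: (eq_Ck openT) => y _; rewrite expr2.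
exact: Ck_continuous C _.
Qed.

Lemma open_euclidean_ball : open (euclidean_ball c r).
Proof.
have -> : euclidean_ball c r = dist2 @^-1` [set t | t < r ^+ 2] by [].
apply: open_comp; last exact: open_lt.
by move=> x _; exact: continuous_sqr_dist.
Qed.

Lemma compact_sqr_dist_le (d : R) : compact [set x | dist2 x <= d].
Proof.
apply: bounded_closed_compact.
  (* For [a >= 0], [a ^+ 2 <= |d|] implies [a <= |d| + 1], which avoids a square root. *)
  exists (`|d| + 1 + `|c|); split; first exact: num_real.
  move=> M dM x /= xd; apply: le_trans (ltW dM).
  rewrite [leLHS]mx_normrE; apply/bigmax_leP; split.
    by rewrite !addr_ge0.
  move=> [i j] _ /=; rewrite (ord1 i) -[x ord0 j](subrK (c ord0 j)).
  rewrite (le_trans (ler_normD _ _))// lerD//; last first.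
    rewrite [leRHS]mx_normrE.
    by apply: (le_bigmax _ (fun ij => `|c ij.1 ij.2|) (ord0, j)).
  have : (x ord0 j - c ord0 j) ^+ 2 <= `|d|.
    rewrite (le_trans _ (ler_norm d))// (le_trans _ xd)//.
    rewrite /dist2 (bigD1 j)//= lerDl; apply: sumr_ge0 => k _; exact: sqr_ge0.
  rewrite -real_normK ?num_real//; move: `|_ - _| (normr_ge0 (x ord0 j - c ord0 j)).
  by move=> a a0; nra.
rewrite (_ : [set _ | _] = dist2 @^-1` [set t | t <= d])//.
apply: closed_comp; last exact: closed_le.
by move=> x _; exact: continuous_sqr_dist.
Qed.

Lemma sqr_dist_convex (d t : R) x y : 0 <= t <= 1 -> dist2 x <= d -> dist2 y <= d ->
  dist2 (x + t *: (y - x)) <= d.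
Proof.
move=> /andP[t0 t1] xd yd.
apply: (@le_trans _ _ ((1 - t) * dist2 x + t * dist2 y)).
  rewrite /dist2 !mulr_sumr -big_split/=; apply: ler_sum => i _.
  rewrite !mxE; move: (x ord0 i) (y ord0 i) (c ord0 i) => a b e.
  (* This product is the convexity defect of the square: the convex combination of the two squares
     minus the square of the convex combination. *)
  have : 0 <= t * (1 - t) * (b - a) ^+ 2.
    by apply: mulr_ge0; [apply: mulr_ge0; lra|exact: sqr_ge0].
  nra.
have := ler_wpM2l t0 yd; have : (1 - t) * dist2 x <= (1 - t) * d.
  by rewrite ler_wpM2l// subr_ge0.
lra.
Qed.

Lemma euclidean_ball_star x0 x : euclidean_ball c r x0 -> euclidean_ball c r x ->
  exists K : set 'rV[R]_n, [/\ compact K, K `<=` euclidean_ball c r, nbhs x K &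
    forall y (t : R), K y -> 0 <= t <= 1 -> K (x0 + t *: (y - x0))].
Proof.
(* [K] is the closed ball about [c] of squared radius [d], midway between the larger squared
   distance and [r ^+ 2]. Being below [r ^+ 2], [d] keeps [K] inside the open ball; being above both
   distances, it makes [K] a neighbourhood of [x] containing [x0], and convexity makes [K]
   star-shaped about [x0]. *)
move=> x0U xU; pose d := (Num.max (dist2 x0) (dist2 x) + r ^+ 2) / 2.
have dr : Num.max (dist2 x0) (dist2 x) < r ^+ 2 by rewrite gt_max x0U.
have dr2 : d < r ^+ 2 by rewrite /d; lra.
have md : Num.max (dist2 x0) (dist2 x) < d by rewrite /d; lra.
move: md; rewrite gt_max => /andP[x0d xd].
exists [set y | dist2 y <= d]; split.
- exact: compact_sqr_dist_le.
- by move=> y /= yd; exact: le_lt_trans dr2.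
- have : nbhs (dist2 x) [set t | t < d] by apply: open_nbhs_nbhs; split=> //; exact: open_lt.
  move=> /continuous_sqr_dist.
  by apply: (@filterS _ (nbhs x)) => y /ltW.
- by move=> y t yd t01; apply: sqr_dist_convex => //; exact: ltW.
Qed.

End euclidean_ball.

Theorem theorem2 (R : realType) (n : nat) (n_gt0 : (0 < n)%N)
    (c : 'rV[R]_n) (r : R) (r_gt0 : 0 < r)
    (x0 : 'rV[R]_n) (x0U : euclidean_ball c r x0)
    (g : 'rV[R]_n -> 'M[R]_n) (gP : riemannian_metric (euclidean_ball c r) g)
    (o : bool) (k : nat) (k_le_n : (k <= n)%N) :
  direct_sum (Lambda k (euclidean_ball c r))
             (coexact k (euclidean_ball c r) g o)
             (anticoexact k (euclidean_ball c r) g o x0).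
Proof.
apply: coexact_anticoexact_direct_sum => //.
- exact: open_euclidean_ball.
- by move=> x; exact: euclidean_ball_star.
Qed.
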